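(* Let $k$ be a local field of characteristic zero. If $n\ge 3$ is odd, then every discrete subgroup of $\mathrm{SL}_n(k)$ acting properly discontinuously on $\mathrm{SL}_n(k)/\mathrm{SL}_{n-1}(k)$ is virtually cyclic.
   Context: A local field of characteristic zero is $\mathbb{R}$, $\mathbb{C}$, or a finite extension of $\mathbb{Q}_p$. $\mathrm{SL}_{n-1}(k)$ is viewed as a subgroup of $\mathrm{SL}_n(k)$ by embedding $(n-1)\times(n-1)$ matrices in the upper left corner of $n\times n$ matrices (with last diagonal entry $1$). A group is virtually cyclic if it has a cyclic subgroup of finite index (in particular finite groups are virtually cyclic). A discrete subgroup $\Gamma$ acts properly discontinuously on $G/H$ if for every compact $L\subset G/H$ the set $\{\gamma\in\Gamma : \gamma L\cap L\neq\emptyset\}$ is finite. *)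

(* Defs.v *)
From HB Require Import structures.
From mathcomp Require Import all_boot all_order all_algebra all_field.
From mathcomp Require Import generic_quotient complex.
From mathcomp Require Import all_classical all_reals all_analysis.

Set Implicit Arguments.
Unset Strict Implicit.
Unset Printing Implicit Defensive.

Import Order.TTheory GRing.Theory Num.Theory.
Import numFieldNormedType.Exports.

Local Open Scope classical_set_scope.
Local Open Scope ring_scope.

HB.mixin Record isAbsValued (R : realType) K of GRing.Field K := {
  absv : K -> R;
  absv_ge0 : forall x, 0 <= absv x;
  absv_eq0 : forall x, (absv x == 0) = (x == 0);
  absvM : forall x y, absv (x * y) = absv x * absv y;
  absvD : forall x y, absv (x + y) <= absv x + absv y
}.

#[short(type="absValuedFieldType")]
HB.structure Definition AbsValuedField (R : realType) :=
  {K of isAbsValued R K & GRing.Field K}.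

(* The type K with the metric topology of the distance absv (x - y). It is an
   alias, and not a structure on K itself, because the library's normed modules
   require `|x *+ n| = `|x| *+ n, which fails for ultrametric fields. *)
Definition absv_space (R : realType) (K : absValuedFieldType R) : Type := K.

Section AbsvSpace.
Variables (R : realType) (K : absValuedFieldType R).
Implicit Types x y : K.

Lemma absv0 : absv (0 : K) = 0 :> R.
Proof. by apply/eqP; rewrite absv_eq0. Qed.

Lemma absv1 : absv (1 : K) = 1 :> R.
Proof.
have n0 : absv (1 : K) != 0 :> R by rewrite absv_eq0 oner_neq0.
by apply: (mulIf n0); rewrite -absvM !mul1r.
Qed.

Lemma absvN x : absv (- x) = absv x :> R.
Proof.
suff N1 : absv (- 1 : K) = 1 :> R by rewrite -mulN1r absvM N1 mul1r.
apply/eqP; rewrite -(@pexpr_eq1 R _ 2) ?absv_ge0//.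
by rewrite expr2 -absvM mulrNN mulr1 absv1.
Qed.

Definition absv_dist x y : R := absv (x - y).

Lemma absv_distxx x : absv_dist x x = 0.
Proof. by rewrite /absv_dist subrr absv0. Qed.

Lemma absv_dist_eq0 x y : absv_dist x y = 0 -> x = y.
Proof. by move=> /eqP; rewrite /absv_dist absv_eq0 subr_eq0 => /eqP. Qed.

Lemma absv_dist_sym x y : absv_dist x y = absv_dist y x.
Proof. by rewrite /absv_dist -absvN opprB. Qed.

Lemma absv_dist_triangle y x z :
  absv_dist x z <= absv_dist x y + absv_dist y z.
Proof. by rewrite /absv_dist (le_trans _ (absvD _ _))// addrA subrK. Qed.

HB.instance Definition _ := Choice.on (absv_space K).
HB.instance Definition _ := isPointed.Build (absv_space K) (0 : K).
HB.instance Definition _ := @isMetric.Build R (absv_space K)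
  absv_dist absv_distxx absv_dist_eq0 absv_dist_sym absv_dist_triangle.

End AbsvSpace.

Section LocalField.
Variable R : realType.

(* |q|_p = p ^ (v_p(denominator) - v_p(numerator)) *)
Definition padic_abs (p : nat) (q : rat) : R :=
  if q == 0 then 0
  else p%:R ^+ logn p `|denq q|%N / p%:R ^+ logn p `|numq q|%N.

(* K is Q_p, i.e. the completion of rat for the p-adic absolute value. *)
Definition is_padic_field (p : nat) (K : absValuedFieldType R) : Prop :=
  [/\ forall q : rat, absv (ratr q : K) = padic_abs p q,
      dense (range (ratr : rat -> K) : set (absv_space K)) &
      forall F : set_system (absv_space K),
        ProperFilter F -> cauchy F -> cvg F].

(* In the p-adic case the absolute value of k is the extension of the one of
   Q_p to its finite extension L; that extension is unique. *)
Definition local_field_char0 (k : absValuedFieldType R) : Prop :=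
  [\/ exists f : {rmorphism R -> k},
        bijective f /\ forall x : R, absv (f x) = `|x|,
      exists f : {rmorphism R[i] -> k},
        bijective f /\ forall z : R[i], (absv (f z))%:C%C = `|z| |
      exists (p : nat) (Qp : absValuedFieldType R) (L : fieldExtType Qp)
             (f : {rmorphism L -> k}),
        [/\ prime p, is_padic_field p Qp, bijective f &
            forall x : Qp, absv (f x%:A) = absv x]].

End LocalField.

Section SpecialLinear.
Variables (k : fieldType) (n : nat).

Definition SL : Type := {A : 'M[k]_n | \det A == 1}.

HB.instance Definition _ := Choice.on SL.
HB.instance Definition _ := SubType.on SL.

Implicit Types A B : SL.

Lemma SL_unitmx A : sval A \in unitmx.
Proof. by rewrite unitmxE (eqP (svalP A)) unitr1. Qed.

Lemma SL_one_subproof : \det (1%:M : 'M[k]_n) == 1.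
Proof. by rewrite det1. Qed.

Lemma SL_mul_subproof A B : \det (sval A *m sval B) == 1.
Proof. by rewrite det_mulmx (eqP (svalP A)) (eqP (svalP B)) mulr1. Qed.

Lemma SL_inv_subproof A : \det (invmx (sval A)) == 1.
Proof. by rewrite det_inv (eqP (svalP A)) invr1. Qed.

Definition SL_one : SL :=
  exist (fun M => \det M == 1) _ SL_one_subproof.
Definition SL_mul A B : SL := exist (fun M => \det M == 1) _ (SL_mul_subproof A B).
Definition SL_inv A : SL := exist (fun M => \det M == 1) _ (SL_inv_subproof A).

Lemma SL_mulA : associative SL_mul.
Proof. by move=> A B C; apply/val_inj; rewrite /= mulmxA. Qed.

Lemma SL_mul1 : left_id SL_one SL_mul.
Proof. by move=> A; apply/val_inj; rewrite /= mul1mx. Qed.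

Lemma SL_mulr1 : right_id SL_one SL_mul.
Proof. by move=> A; apply/val_inj; rewrite /= mulmx1. Qed.

Lemma SL_mulV : left_inverse SL_one SL_inv SL_mul.
Proof. by move=> A; apply/val_inj; rewrite /= mulVmx ?SL_unitmx. Qed.

Lemma SL_mulrV : right_inverse SL_one SL_inv SL_mul.
Proof. by move=> A; apply/val_inj; rewrite /= mulmxV ?SL_unitmx. Qed.

HB.instance Definition _ :=
  isGroup.Build SL SL_mulA SL_mul1 SL_mulr1 SL_mulV SL_mulrV.

End SpecialLinear.

HB.instance Definition _ (R : realType) (k : absValuedFieldType R) (n : nat) :=
  Topological.copy (SL k n)
    (initial_topology (sval : SL k n -> 'M[absv_space k]_n)).

(* A in the upper left corner, 1 as last diagonal entry, 0 elsewhere. *)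
Definition corner_mx (k : fieldType) (n : nat) (A : 'M[k]_n.-1) : 'M[k]_n :=
  \matrix_(i, j)
    match insub (i : nat), insub (j : nat) with
    | Some i', Some j' => A i' j'
    | _, _ => (i == j)%:R
    end.

Definition SL_corner (k : fieldType) (n : nat) : set (SL k n) :=
  [set g | exists h : SL k n.-1, sval g = corner_mx (sval h)].
Arguments SL_corner : clear implicits.

Section CosetSpace.
Local Open Scope group_scope.
Local Open Scope quotient_scope.
Variables (G : groupType) (H : set G).

Definition left_coset (g : G) : set G := [set g * h | h in H].

Definition eq_coset : rel G := fun g1 g2 => `[< left_coset g1 = left_coset g2 >].

Lemma eq_coset_equiv : equiv_class_of eq_coset.
Proof.
split=> [g|g1 g2|g2 g1 g3]; rewrite /eq_coset; first exact/asboolP.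
  by apply/asboolP/asboolP.
by move=> /asboolP e /asboolP <-; apply/asboolP.
Qed.

Canonical eq_coset_rel := EquivRelPack eq_coset_equiv.

(* The space G / H of left cosets g H. *)
Definition coset_space : quotType G := {eq_quot eq_coset_rel}%qT.

(* g . (x H) = (g x) H *)
Definition coset_act (g : G) (x : coset_space) : coset_space :=
  \pi_coset_space (g * repr x).

Lemma coset_actE g x :
  coset_act g (\pi_coset_space x) = \pi_coset_space (g * x).
Proof.
apply/eqmodP/asboolP.
have /eqmodP/asboolP e : repr (\pi_coset_space x) = x %[mod coset_space].
  by rewrite reprK.
have lM y : left_coset (g * y) = [set g * z | z in left_coset y].
  apply/seteqP; split=> [_ [h Hh <-]|_ [_ [h Hh <-] <-]].
    by exists (y * h); [exists h | rewrite mulgA].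
  by exists h; rewrite // mulgA.
by rewrite !lM e.
Qed.

End CosetSpace.

Definition cyclic_subgroup (G : groupType) (c : G) : set G :=
  [set x | exists m : nat, x = (c ^+ m)%g \/ x = (c ^- m)%g].

Arguments coset_act {G} H g x.

Definition virtually_cyclic (G : groupType) (Gam : set G) : Prop :=
  exists2 c, Gam c &
    finite_set [set left_coset (cyclic_subgroup c) g | g in Gam].

Definition discrete_subset (T : topologicalType) (A : set T) : Prop :=
  A `<=` isolated A.

Section ProperAction.
Variables (R : realType) (k : absValuedFieldType R) (n : nat).

Definition properly_discontinuous (H Gam : set (SL k n)) : Prop :=
  forall L : set (quotient_topology (coset_space H)), compact L ->
    finite_set [set g | Gam g /\ (coset_act H g @` L) `&` L !=set0].

End ProperAction.

(* Main.v *)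
Require Import Defs.
From HB Require Import structures.
From mathcomp Require Import all_boot all_order all_algebra all_fingroup all_field.
From mathcomp Require Import generic_quotient complex finmap.
From mathcomp Require Import all_classical all_reals all_analysis.
From mathcomp Require Import ring lra zify.

Set Implicit Arguments.
Unset Strict Implicit.
Unset Printing Implicit Defensive.

Import Order.TTheory GRing.Theory Num.Theory.
Import numFieldNormedType.Exports.

Local Open Scope classical_set_scope.
Local Open Scope ring_scope.

(** Why the theorem is true. Write n = 2 d - 1. For g in SL_n(k) compare the
    d-th largest singular value s(g) (over a p-adic field, the absolute value of
    the d-th elementary divisor) with 1. As d is the middle index,
    s(g^-1) = 1 / s(g), and s(a g) / s(g), s(g a) / s(g) stay in a compact
    interval depending only on a. If s(g) is bounded away from 0 and infinity,
    then the Cartan decomposition of g has a middle diagonal entry of bounded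
    size, so g lies in X SL_{n-1}(k) X for some fixed compact X. A group
    Gam acting properly on SL_n(k) / SL_{n-1}(k) has only finitely many such
    elements. Hence the set A of all g with s(g) >= 1 has two properties, both
    up to finitely many elements of Gam: it is invariant under left and right
    translations by Gam, and g |-> g^-1 exchanges it with its complement.

    This is enough when Gam contains an element g of infinite order. The
    indicator function of A has distinct limits along the two ends of <g>, hence
    along the two ends of every coset y <g>. So every coset contains a z such that
    exactly one of z and z g is in A, and there are only finitely many such z: [virtually_cyclic_infinite_order].

    Suppose now that Gam is a torsion group. Then its finitely generated
    subgroups are finite ([torsion_locally_finite]): in an infinite one, an
    element g of A far from the boundary of A would map A strictly into itself.
    The linear span of Gam is then the span of a finite subgroup, on which the
    trace form is nondegenerate by Maschke averaging. The traces of elements of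
    finite order are bounded ([trace_isometry]), so Gam is bounded
    ([torsion_bounded]), and therefore finite by properness.

    To treat all local fields uniformly, singular values are replaced by
    subspaces of dimension d on which g expands or contracts the l1 norm, and
    the Cartan decomposition by Gaussian elimination with complete pivoting
    ([bounded_diagonalization]). The field enters only through its characteristic
    and the compactness of its balls ([local_field_heine_borel]). *)

(** * Groups with a bi-almost invariant set exchanged with its complement by inversion *)

Section BiAlmostInvariantSets.
Local Open Scope group_scope.
Variables (G : groupType) (Gam A : set G).
Hypothesis Gam1 : Gam 1.
Hypothesis GamM : forall x y, Gam x -> Gam y -> Gam (x * y).
Hypothesis GamV : forall x, Gam x -> Gam x^-1.
Hypothesis A_left : forall d, Gam d ->
  finite_set [set g | Gam g /\ ~ (A (d * g) <-> A g)].
Hypothesis A_right : forall d, Gam d ->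
  finite_set [set g | Gam g /\ ~ (A (g * d) <-> A g)].
Hypothesis A_inv : finite_set [set g | Gam g /\ (A g^-1 <-> A g)].

Lemma left_coset_cyclicM (c y : G) :
  left_coset (cyclic_subgroup c) (y * c) = left_coset (cyclic_subgroup c) y.
Proof.
have cC h : cyclic_subgroup c h -> cyclic_subgroup c (c * h).
  move=> [m [->|->]]; first by exists m.+1; left; rewrite expgS.
  case: m => [|m]; first by exists 1%N; left; rewrite expg0 invg1 mulg1 expg1.
  by exists m; right; rewrite expgSr invgM mulVKg.
have cVC h : cyclic_subgroup c h -> cyclic_subgroup c (c^-1 * h).
  move=> [m [->|->]]; last by exists m.+1; right; rewrite expgSr invgM.
  case: m => [|m]; first by exists 1%N; right; rewrite expg0 mulg1 expg1.
  by exists m; left; rewrite expgS mulKg.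
apply/seteqP; split=> _ [h Ch <-].
  by exists (c * h); rewrite ?mulgA//; exact: cC.
by exists (c^-1 * h); [exact: cVC|rewrite -mulgA mulVKg].
Qed.

Lemma GamX g m : Gam g -> Gam (g ^+ m).
Proof. by move=> Gg; elim: m => [|m IH]; rewrite ?expg0// expgS; apply: GamM. Qed.

(** For |m| large y g^m is on the same side of A as g^m, and g^m and g^-m are on
    opposite sides. So the membership of y g^m in A changes at some m, and every
    coset y <g> meets the finite set of the z for which z and z g are separated
    by A. *)
Lemma virtually_cyclic_infinite_order g : Gam g ->
  (forall m, (0 < m)%N -> g ^+ m <> 1) -> virtually_cyclic Gam.
Proof.
move=> Gg ginf; exists g => //.
have expI : injective (fun m => g ^+ m).
  move=> a b; wlog ab : a b / (a <= b)%N.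
    by move=> H; case: (leqP a b) => [/H//|/ltnW /H H' /esym /H'].
  rewrite /= -(subnKC ab) expgnDr -[LHS]mulg1 => /mulgI /esym e.
  case: (posnP (b - a)) => [->|/ginf //]; by rewrite addn0.
set D := [set z | Gam z /\ ~ (A (z * g) <-> A z)].
apply: (@sub_finite_set _ _ (left_coset (cyclic_subgroup g) @` D)); last first.
  exact/finite_image/A_right.
move=> _ [y Gy <-].
pose z (m : nat) b := if b then y * g ^+ m else y * g ^- m.
have Gz m b : Gam (z m b).
  by rewrite /z; case: b; apply: GamM => //; last apply: GamV; apply: GamX.
have cz m b : left_coset (cyclic_subgroup g) (z m b) =
              left_coset (cyclic_subgroup g) y.
  rewrite /z; case: b.
    elim: m => [|m IH]; rewrite ?expg0 ?mulg1//.
    by rewrite expgSr mulgA left_coset_cyclicM.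
  elim: m => [|m IH]; rewrite ?expg0 ?invg1 ?mulg1//.
  by rewrite -left_coset_cyclicM expgS invgM mulgA mulgVK.
have [[m [b Dz]]|noD] := pselect (exists m b, D (z m b)).
  by exists (z m b).
exfalso.
have AD m b : A (z m b * g) <-> A (z m b).
  by apply: contrapT => nA; apply: noD; exists m, b.
have Az m b : A (z m b) <-> A y.
  case: b; elim: m => [|m IH]; rewrite /z ?expg0 ?invg1 ?mulg1//.
    rewrite expgSr mulgA; have := AD m true; rewrite /z.
    by move=> e; apply: iff_trans e IH.
  have := AD m.+1 false; rewrite /z {1}expgS invgM mulgA mulgVK => e.
  exact: (iff_trans (iff_sym e) IH).
pose E := [set x | Gam x /\ ~ (A (y * x) <-> A x)].
have finE : finite_set E by exact: A_left.
pose B := [set m | E (g ^+ m) \/ E (g ^- m) \/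
  (Gam (g ^+ m) /\ (A (g ^+ m)^-1 <-> A (g ^+ m)))].
have finB : finite_set B.
  have -> : B = ((fun m => g ^+ m) @^-1` E) `|` (((fun m => g ^- m) @^-1` E)
     `|` ((fun m => g ^+ m) @^-1` [set g | Gam g /\ (A g^-1 <-> A g)])) by [].
  rewrite !finite_setU; split; last split; apply: finite_preimage => //;
    by move=> a b _ _ /= e; apply: expI; first [exact: e | exact: invg_inj e].
have [m nB] : exists m, ~ B m.
  apply: contrapT => /forallNP allB; apply: infinite_nat.
  by apply: sub_finite_set finB => m _; apply: contrapT; exact: allB.
have := Az m true; have := Az m false; rewrite /z => eF eT.
have GT := GamX m Gg; have GF := GamV GT.
have e1 : A (y * g ^+ m) <-> A (g ^+ m).
  by apply: contrapT => ne; apply: nB; left.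
have e2 : A (y * g ^- m) <-> A (g ^- m).
  by apply: contrapT => ne; apply: nB; right; left.
apply: nB; right; right; split=> //.
exact: (iff_trans (iff_trans (iff_sym e2) eF) (iff_trans (iff_sym eT) e1)).
Qed.

(** For S closed under inversion this is the subgroup generated by S; it comes
    with induction on words, multiplying by a letter on the right. *)
Definition gen_words (S : set G) : set G :=
  [set x | forall X : set G, X 1 ->
     (forall y s, X y -> S s -> X (y * s)) -> X x].

Section Generated.
Variable S : set G.
Hypothesis SV : forall s, S s -> S s^-1.

Lemma gen_words1 : gen_words S 1. Proof. by move=> X. Qed.

Lemma gen_wordsMr x s : gen_words S x -> S s -> gen_words S (x * s).
Proof. move=> Lx Ss X X1 XM; exact: XM (Lx X X1 XM) Ss. Qed.

Lemma gen_words_sub s : S s -> gen_words S s.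
Proof. by move=> Ss; rewrite -(mul1g s); apply: gen_wordsMr => //; exact: gen_words1. Qed.

Lemma gen_wordsM x y : gen_words S x -> gen_words S y -> gen_words S (x * y).
Proof.
move=> Lx Ly; apply: (Ly (fun y => gen_words S (x * y))) => [|z s Lz Ss].
  by rewrite mulg1.
by rewrite mulgA; apply: gen_wordsMr.
Qed.

Lemma gen_wordsV x : gen_words S x -> gen_words S x^-1.
Proof.
move=> Lx; apply: (Lx (fun x => gen_words S x^-1)) => [|y s Ly Ss].
  by rewrite invg1; exact: gen_words1.
by rewrite invgM; apply: gen_wordsM Ly => //; apply: gen_words_sub; exact: SV.
Qed.

Lemma gen_words_subgroup : S `<=` Gam -> gen_words S `<=` Gam.
Proof. by move=> SG x Lx; apply: Lx => // y s Gy Ss; apply: GamM => //; apply: SG. Qed.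

End Generated.

(** Let L be infinite and let bd be the boundary of A in the Cayley graph of L.
    Only finitely many g have an element of g bd or g^-1 bd on another side of A
    than g or g^-1. As inversion exchanges A and its complement, there is a g
    with g bd inside A and g^-1 bd outside A. Then g maps the part of A in L into
    itself, and moves a boundary point outside A into A, so no power of g is 1. *)
Lemma torsion_locally_finite (S : set G) :
  (forall g, Gam g -> exists2 m, (0 < m)%N & g ^+ m = 1) ->
  finite_set S -> (forall s, S s -> S s^-1) -> S `<=` Gam ->
  finite_set (gen_words S).
Proof.
move=> tors finS SV SG; apply: contrapT => infL.
have LG := gen_words_subgroup SG.
set L := gen_words S in infL LG *.
have L1 : L 1 := @gen_words1 S.
have LM x y : L x -> L y -> L (x * y) := @gen_wordsM S x y.
have LV x : L x -> L x^-1 := @gen_wordsV S SV x.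
have SL s : S s -> L s := @gen_words_sub S s.
pose bd := [set x | L x /\ exists2 s, S s & ~ (A (x * s) <-> A x)].
have finbd : finite_set bd.
  apply: (@sub_finite_set _ _ 
    (\bigcup_(s in S) [set x | Gam x /\ ~ (A (x * s) <-> A x)])).
    by move=> x [Lx [s Ss ne]]; exists s => //; split=> //; exact: LG.
  by apply: bigcup_finite => // s Ss; apply/A_right/SG.
pose F := \bigcup_(b in bd) [set x | Gam x /\ ~ (A (x * b) <-> A x)].
have finF : finite_set F.
  by apply: bigcup_finite => // b [Lb _]; apply/A_right/LG.
have [h [Lh nh]] : exists h, L h /\ ~ (F h \/ F h^-1 \/ (Gam h /\ (A h^-1 <-> A h))).
  apply: contrapT => /forallNP hall; apply: infL.
  apply: (@sub_finite_set _ _ 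
    (F `|` ((fun x => x^-1) @^-1` F `|`
      [set g | Gam g /\ (A g^-1 <-> A g)]))).
    by move=> x Lx; apply: contrapT => nx; apply: (hall x).
  rewrite !finite_setU; split=> //; split=> //.
  by apply: finite_preimage => // a b _ _ /invg_inj.
have [g [Lg Ag nAg Fg FgV]] : exists g, [/\ L g, A g, ~ A g^-1, ~ F g & ~ F g^-1].
  have nI : ~ (A h^-1 <-> A h) 
    by move=> e; apply: nh; right; right; split=> //; apply: LG.
  have [Ah|nAh] := pselect (A h).
    by exists h; split=> //; tauto.
  exists h^-1; rewrite invgK; split; [exact: LV| |tauto|tauto|tauto].
  by apply: contrapT => nAhV; apply: nI.
have bdg b : bd b -> A (g * b).
  move=> bb; have /iffRL : A (g * b) <-> A g; last exact.
  by apply: contrapT => ne; apply: Fg; exists b => //; split=> //; exact: LG.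
have bdgV b : bd b -> ~ A (g^-1 * b).
  move=> bb Ab; apply: nAg; have /iffLR : A (g^-1 * b) <-> A g^-1; last exact.
  apply: contrapT => ne; apply: FgV; exists b => //; split=> //.
  by apply: LG; apply: LV.
(* The points of A which g moves out of A are stable under right multiplication
   by S: they would be all of L, but g sends 1 into A. *)
have gA x : L x -> A x -> A (g * x).
  move=> Lx Ax; apply: contrapT => nAgx.
  have Xall w : L w -> A (x * w) /\ ~ A (g * (x * w)).
    move=> Lw; apply: (Lw (fun w => L w -> A (x * w) /\ ~ A (g * (x * w)))) => //.
      by rewrite mulg1.
    move=> y s IH Ss Lys.
    have Ly : L y by rewrite -(mulgK s y); apply: LM => //; apply: LV; apply: SL.
    have [Axy nAgxy] := IH Ly.
    split; rewrite !mulgA; apply: contrapT => H.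
      have bxy : bd (x * y) by split; [exact: LM|exists s => //; tauto].
      by apply: nAgxy; apply: bdg.
    have bxy : bd (g * (x * y)).
      split; first exact: LM _ _ Lg (LM _ _ Lx Ly).
      by exists s => //; rewrite !mulgA in nAgxy *; tauto.
    by apply: (bdgV _ bxy); rewrite mulKg.
  have := Xall (x^-1) (LV _ Lx); rewrite mulgV mulg1 => -[_]; exact.
have [y [Ly nAy [s Ss Ays]]] : exists y, [/\ L y, ~ A y & exists2 s, S s & A (y * s)].
  apply: contrapT => H.
  have up y s : L y -> S s -> A (y * s) -> A y.
    by move=> Ly Ss Ays; apply: contrapT => nAy; apply: H; exists y; split=> //; exists s.
  have Aiff x : L x -> (A x <-> A 1).
    move=> Lx; apply: (Lx (fun x => L x -> (A x <-> A 1))) => // y s IH Ss Lys.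
    have Ly : L y by rewrite -(mulgK s y); apply: LM => //; apply: LV; apply: SL.
    rewrite -(IH Ly); split; first exact: up.
    by rewrite -{1}(mulgK s y); apply: up => //; exact: SV.
  by apply: nAg; apply/(Aiff _ (LV _ Lg))/(Aiff _ Lg).
have Agy : A (g * y) by apply: bdg; split=> //; exists s => //; tauto.
have [m m0 gm] := tors g (LG _ Lg).
have Agm j : A (g ^+ j.+1 * y).
  elim: j => [|j IH]; first by rewrite expg1.
  have Lgj i : L (g ^+ i).
    by elim: i => [|i IHi]; rewrite ?expg0// expgS; exact: LM.
  by rewrite expgS -mulgA; apply: gA => //; exact: LM.
by apply: nAy; have := Agm m.-1; rewrite prednK// gm mul1g.
Qed.

End BiAlmostInvariantSets.

(** * The l1 norm of matrices and elimination with complete pivoting *)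

Section MatrixNorm.
Variables (R : realType) (K : absValuedFieldType R).

Definition mxnorm (p q : nat) (M : 'M[K]_(p, q)) : R :=
  \sum_i \sum_j absv (M i j).

Lemma mxnorm_ge0 p q (M : 'M[K]_(p, q)) : 0 <= mxnorm M.
Proof. by apply: sumr_ge0 => i _; apply: sumr_ge0 => j _; apply: absv_ge0. Qed.

Lemma absv_le_mxnorm p q (M : 'M[K]_(p, q)) i j : absv (M i j) <= mxnorm M.
Proof.
rewrite /mxnorm (bigD1 i)//= (bigD1 j)//= -addrA ler_wpDr// addr_ge0//.
  by apply: sumr_ge0 => ? _; apply: absv_ge0.
by apply: sumr_ge0 => ? _; apply: sumr_ge0 => ? _; apply: absv_ge0.
Qed.

Lemma mxnorm_eq0 p q (M : 'M[K]_(p, q)) : mxnorm M = 0 -> M = 0.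
Proof.
move=> M0; apply/matrixP => i j; rewrite mxE; apply/eqP.
by rewrite -(absv_eq0 (s := K)) -(@le_anti _ R (absv (M i j)) 0)//
  absv_ge0 andbT -M0 absv_le_mxnorm.
Qed.

Lemma mxnorm_le_const p q (M : 'M[K]_(p, q)) b :
  (forall i j, absv (M i j) <= b) -> mxnorm M <= b *+ q *+ p.
Proof.
move=> Mb; apply: (le_trans (y := \sum_(i < p) \sum_(j < q) b)).
  by apply: ler_sum => i _; apply: ler_sum.
by rewrite !sumr_const !card_ord.
Qed.

Lemma absv_sum (I : finType) (P : pred I) (F : I -> K) :
  absv (\sum_(i | P i) F i) <= \sum_(i | P i) (absv (F i) : R).
Proof.
elim/big_rec2: _ => [|i y x _ le_xy]; first by rewrite absv0.
by rewrite (le_trans (absvD _ _))// lerD2l.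
Qed.

Lemma absv_prod (I : finType) (P : pred I) (F : I -> K) :
  absv (\prod_(i | P i) F i) = \prod_(i | P i) (absv (F i) : R).
Proof. by elim/big_rec2: _ => [|i y x _ <-]; rewrite ?absv1 ?absvM. Qed.

Lemma absvV (x : K) : absv x^-1 = (absv x)^-1 :> R.
Proof.
have [->|x0] := eqVneq x 0; first by rewrite invr0 absv0 invr0.
have ax0 : absv x != 0 :> R by rewrite absv_eq0.
by apply: (mulfI ax0); rewrite -absvM !divff// absv1.
Qed.

Lemma absv_sign b : absv ((-1) ^+ b : K) = 1 :> R.
Proof. by elim: b => [|b IH]; rewrite ?expr0 ?absv1// exprS mulN1r absvN. Qed.

Lemma mxnormM p q r (M : 'M[K]_(p, q)) (N : 'M[K]_(q, r)) :
  mxnorm (M *m N) <= mxnorm M * mxnorm N.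
Proof.
rewrite /mxnorm mulr_suml; apply: ler_sum => i _.
rewrite mulr_suml (le_trans (y := \sum_j \sum_k (absv (M i k) * absv (N k j) : R)))//.
  apply: ler_sum => j _; rewrite mxE (le_trans (absv_sum _ _))//.
  by apply: ler_sum => k _; rewrite absvM.
rewrite exchange_big/=; apply: ler_sum => k _; rewrite -mulr_sumr.
rewrite ler_wpM2l ?absv_ge0// [leRHS](bigD1 k)//= ler_wpDr// sumr_ge0// => ? _.
by rewrite sumr_ge0// => ? _; apply: absv_ge0.
Qed.

Lemma mxnorm_block p1 p2 q1 q2 (A : 'M[K]_(p1, q1)) (B : 'M[K]_(p1, q2))
    (C : 'M[K]_(p2, q1)) (D : 'M[K]_(p2, q2)) :
  mxnorm (block_mx A B C D) = mxnorm A + mxnorm B + (mxnorm C + mxnorm D).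
Proof.
rewrite /mxnorm big_split_ord/=; congr (_ + _); rewrite -big_split/=;
  apply: eq_bigr => i _; rewrite big_split_ord/=; congr (_ + _);
  apply: eq_bigr => j _; by rewrite ?block_mxEul ?block_mxEur ?block_mxEdl ?block_mxEdr.
Qed.

Lemma mxnorm0 p q : mxnorm (0 : 'M[K]_(p, q)) = 0.
Proof. by rewrite /mxnorm big1// => i _; rewrite big1// => j _; rewrite mxE absv0. Qed.

Lemma mxnorm1 p : mxnorm (1%:M : 'M[K]_p) = p%:R.
Proof.
rewrite /mxnorm -[p in RHS]card_ord -sumr_const; apply: eq_bigr => i _.
rewrite (bigD1 i)//= mxE eqxx mulr1n absv1 big1 ?addr0// => j ji.
by rewrite mxE eq_sym (negPf ji) absv0.
Qed.

Lemma mxnormN p q (M : 'M[K]_(p, q)) : mxnorm (- M) = mxnorm M.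
Proof. by apply: eq_bigr => i _; apply: eq_bigr => j _; rewrite mxE absvN. Qed.

Lemma mxnorm_tperm p (i j : 'I_p) :
  mxnorm (tperm_mx i j : 'M[K]_p) <= 1 *+ p *+ p.
Proof.
apply: mxnorm_le_const => k l; rewrite !mxE.
by case: eqP => _; rewrite ?mulr1n ?mulr0n ?absv1 ?absv0 ?ler01.
Qed.

Definition bounded_unit (p : nat) (c : R) (u : 'M[K]_p) : Prop :=
  exists w, [/\ u *m w = 1%:M, mxnorm u <= c & mxnorm w <= c].

Lemma bounded_unitM p c c' (u u' : 'M[K]_p) :
  bounded_unit c u -> bounded_unit c' u' -> bounded_unit (c * c') (u *m u').
Proof.
move=> [w [uw uc wc]] [w' [uw' uc' wc']]; exists (w' *m w); split.
- by rewrite mulmxA -(mulmxA u) uw' mulmx1.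
- by rewrite (le_trans (mxnormM _ _))// ler_pM// mxnorm_ge0.
- by rewrite (le_trans (mxnormM _ _))// mulrC ler_pM// mxnorm_ge0.
Qed.

Lemma bounded_unit_tperm p (i j : 'I_p) :
  bounded_unit (1 *+ p *+ p) (tperm_mx i j).
Proof.
exists (tperm_mx i j); split; rewrite ?mxnorm_tperm//.
by rewrite -perm_mxM tperm2 perm_mx1.
Qed.

(** The pivot is an entry of largest absolute value, so the elimination
    multipliers have absolute value at most 1. *)
Lemma bounded_diagonalization (p : nat) :
  exists c : R, forall M : 'M[K]_p, exists u v (a : 'rV_p),
    [/\ bounded_unit c u, bounded_unit c v & M = u *m diag_mx a *m v].
Proof.
elim: p => [|p [c IH]].
  have bu (u : 'M[K]_0) : bounded_unit 0 u.
    by exists 0; split; rewrite ?(flatmx0 u) ?mxnorm0//; apply/matrixP => -[].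
  exists 0 => M; exists 0, 0, 0; split; [exact: bu|exact: bu|].
  by rewrite [M]flatmx0 !mul0mx.
pose t : R := 1 *+ p.+1 *+ p.+1.
pose m : R := 1 + 0 + (1 *+ 1 *+ p + p%:R).
exists (t * m * (1 + c) + (1 + c) * m * t) => M.
set f := fun ij : 'I_p.+1 * 'I_p.+1 => absv (M ij.1 ij.2) : R.
have [[i j]/= _ Mij] := @Order.TotalTheory.arg_maxP _ R _ (ord0, ord0) xpredT f isT.
pose M' : 'M[K]_(1 + p) := tperm_mx i 0 *m M *m tperm_mx 0 j.
have ME : M = tperm_mx i 0 *m M' *m tperm_mx 0 j.
  by rewrite /M' !mulmxA -perm_mxM tperm2 perm_mx1 mul1mx
    -mulmxA -perm_mxM tperm2 perm_mx1 mulmx1.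
have M'E k l : M' k l = M (tperm i 0 k) (tperm 0 j l).
  by rewrite /M' -xcolE -xrowE !mxE.
have M'le k l : absv (M' k l) <= absv (M' 0 0) :> R.
  rewrite !M'E tpermR tpermL; exact: (Mij (_, _) isT).
clearbody M'.
pose x := ulsubmx M'; pose r := ursubmx M'; pose l := dlsubmx M'; pose N := drsubmx M'.
have M'B : M' = block_mx x r l N by rewrite submxK.
pose y := M' 0 0.
have xE : x = y%:M.
  rewrite [x]mx11_scalar; congr scalar_mx; rewrite !mxE; congr (M' _ _); exact/val_inj.
have y0 (z : K) : absv z <= absv y :> R -> y * y^-1 * z = z.
  have [->|yn0 _] := eqVneq y 0; last by rewrite divff// mul1r.
  rewrite absv0 mul0r mul0r => z0; apply/esym/eqP; rewrite -(absv_eq0 (s := K)).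
  by rewrite eq_le z0 absv_ge0.
have div_le z : absv z <= absv y :> R -> absv (y^-1 * z) <= 1 :> R.
  have [->|yn0] := eqVneq y 0; first by rewrite invr0 mul0r absv0 ler01.
  by rewrite absvM absvV mulrC ler_pdivrMr ?mul1r//
    lt_neqAle eq_sym absv_eq0 yn0 absv_ge0.
have [u' [v' [a' [bu' bv' Ea']]]] := IH (N - l *m (y^-1 *: r)).
pose Lo : 'M[K]_(1 + p) := block_mx 1%:M 0 (y^-1 *: l) 1%:M.
pose Up : 'M[K]_(1 + p) := block_mx 1%:M (y^-1 *: r) 0 1%:M.
have t0 : 0 <= t by rewrite /t !mulrn_wge0.
have m0 : 0 <= m by rewrite /m addr0 !addr_ge0// mulrn_wge0.
have c0 : 0 <= c by have [w [_ + _]] := bu'; apply: le_trans; exact: mxnorm_ge0.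
have lN : mxnorm (y^-1 *: l) <= 1 *+ 1 *+ p.
  by apply: mxnorm_le_const => k k'; rewrite !mxE; apply: div_le; apply: M'le.
have rN : mxnorm (y^-1 *: r) <= 1 *+ p *+ 1.
  by apply: mxnorm_le_const => k k'; rewrite !mxE; apply: div_le; apply: M'le.
have bLo : bounded_unit m Lo.
  exists (block_mx 1%:M 0 (- (y^-1 *: l)) 1%:M); split.
  - rewrite mulmx_block !mul1mx !mulmx1 !mul0mx !mulmx0 !addr0 add0r subrr.
    by rewrite -scalar_mx_block.
  - by rewrite mxnorm_block !mxnorm1 mxnorm0 lerD// lerD.
  - by rewrite mxnorm_block !mxnorm1 mxnorm0 mxnormN lerD// lerD.
have bUp : bounded_unit m Up.
  have mE : 1 + p%:R + (0 + p%:R) = m by rewrite /m mulr1n addr0 add0r addrA.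
  exists (block_mx 1%:M (- (y^-1 *: r)) 0 1%:M); split.
  - rewrite mulmx_block !mul1mx !mulmx1 !mul0mx !mulmx0 !addr0 !add0r addNr.
    by rewrite -scalar_mx_block.
  - by rewrite mxnorm_block !mxnorm1 mxnorm0 -mE !lerD.
  - by rewrite mxnorm_block !mxnorm1 mxnorm0 mxnormN -mE !lerD.
have bB w : bounded_unit c w ->
    bounded_unit (1 + c) (block_mx 1%:M 0 0 w : 'M[K]_(1 + p)).
  move=> [w' [ww' wc wc']]; exists (block_mx 1%:M 0 0 w'); split.
  - rewrite mulmx_block !mul1mx !mulmx1 !mul0mx !mulmx0 !addr0 !add0r ww'.
    by rewrite -scalar_mx_block.
  - by rewrite mxnorm_block !mxnorm1 !mxnorm0 addr0 add0r lerD2l.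
  - by rewrite mxnorm_block !mxnorm1 !mxnorm0 addr0 add0r lerD2l.
have bmono d d' (w : 'M[K]_p.+1) : d <= d' -> bounded_unit d w -> bounded_unit d' w.
  by move=> dd' [w' [ww' wd w'd]]; exists w'; split=> //; apply: le_trans dd'.
exists (tperm_mx i 0 *m Lo *m block_mx 1%:M 0 0 u'),
       (block_mx 1%:M 0 0 v' *m Up *m tperm_mx 0 j), (row_mx y%:M a'); split.
- apply: (bmono (t * m * (1 + c))).
    by rewrite ler_wpDr// !mulr_ge0// addr_ge0.
  apply: bounded_unitM; last exact: bB.
  by apply: bounded_unitM bLo; apply: bounded_unit_tperm.
- apply: (bmono ((1 + c) * m * t)).
    by rewrite ler_wpDl// !mulr_ge0// addr_ge0.
  apply: bounded_unitM; last exact: bounded_unit_tperm.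
  by apply: bounded_unitM bUp; apply: bB.
- have Er : y%:M *m (y^-1 *: r) = r.
    rewrite mul_scalar_mx scalerA; apply/matrixP => k k'; rewrite mxE.
    by apply: y0; rewrite !mxE; apply: M'le.
  have El : y^-1 *: l *m y%:M = l.
    rewrite mul_mx_scalar scalerA; apply/matrixP => k k'; rewrite mxE.
    by apply: y0; rewrite !mxE; apply: M'le.
  have D1 : diag_mx (y%:M : 'rV_1) = y%:M.
    by apply/matrixP => k k'; rewrite !mxE !ord1.
  rewrite ME M'B xE.
  have -> : block_mx y%:M r l N = Lo *m block_mx 1%:M 0 0 u' *m
      diag_mx (row_mx y%:M a') *m (block_mx 1%:M 0 0 v' *m Up).
    rewrite diag_mx_row D1 !mulmx_block.
    rewrite !(mul1mx, mulmx1, mul0mx, mulmx0, addr0, add0r) El Er.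
    by rewrite -Ea' addrC subrK.
  by rewrite !mulmxA.
Qed.

End MatrixNorm.

(** * Expanded and contracted subspaces *)

Section Expansion.
Variables (R : realType) (K : absValuedFieldType R) (d n : nat).
Implicit Types (g h : 'M[K]_n) (c : R).

(** [expanding c g] says, up to a constant, that the d-th largest singular value
    of g is at least c. Matrices act on row vectors, and the subspace of dimension
    d is the row space of B. *)
Definition expanding c g := exists2 B : 'M[K]_(d, n), row_free B &
  forall x : 'rV_d, c * mxnorm (x *m B) <= mxnorm (x *m B *m g).

Definition contracting c g := exists2 B : 'M[K]_(d, n), row_free B &
  forall x : 'rV_d, mxnorm (x *m B *m g) <= c * mxnorm (x *m B).

(** Two subspaces of dimension d meet when 2 d > n. *)
Lemma expanding_contracting c c' g : (n < d + d)%N ->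
  expanding c g -> contracting c' g -> c <= c'.
Proof.
move=> nd [B /eqP rB eB] [C /eqP rC cC].
have : (B :&: C)%MS != 0.
  rewrite -mxrank_eq0; have := mxrank_sum_cap B C; rewrite rB rC => e.
  by have := rank_leq_col (B + C)%MS; lia.
move=> /rowV0Pn[v]; rewrite sub_capmx => /andP[/submxP[x vB] /submxP[y vC]] v0.
have nv : 0 < mxnorm v.
  by rewrite lt_neqAle mxnorm_ge0 andbT eq_sym; apply: contra_neq v0; exact: mxnorm_eq0.
have := eB x; have := cC y; rewrite -vB -vC => le1 le2.
by have := le_trans le2 le1; rewrite ler_pM2r.
Qed.

Lemma expanding_inv c g g' : 0 < c -> g *m g' = 1%:M ->
  expanding c g -> contracting c^-1 g'.
Proof.
move=> c0 gg' [B fB eB]; exists (B *m g) => [|x].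
  rewrite /row_free mxrankMfree//; apply/row_freeP; by exists g'.
by rewrite !mulmxA -(mulmxA _ g) gg' mulmx1 ler_pdivlMl.
Qed.

Lemma contracting_inv c g g' : 0 < c -> g *m g' = 1%:M ->
  contracting c g -> expanding c^-1 g'.
Proof.
move=> c0 gg' [B fB eB]; exists (B *m g) => [|x].
  rewrite /row_free mxrankMfree//; apply/row_freeP; by exists g'.
by rewrite !mulmxA -(mulmxA _ g) gg' mulmx1 ler_pdivrMl.
Qed.

Lemma expandingMr c c' g h h' : 0 < c' -> h *m h' = 1%:M -> mxnorm h' <= c' ->
  expanding c g -> expanding (c / c') (g *m h).
Proof.
move=> c0 hh' lh [B fB eB]; exists B => // x.
rewrite mulrAC ler_pdivrMr// mulmxA (le_trans (eB x))//.
rewrite -[X in mxnorm X <= _]mulmx1 -hh' mulmxA.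
by rewrite (le_trans (mxnormM _ _))// ler_wpM2l// mxnorm_ge0.
Qed.

Lemma expandingMl c c' g h h' : 0 <= c -> 0 < c' -> h *m h' = 1%:M -> mxnorm h' <= c' ->
  expanding c g -> expanding (c / c') (h *m g).
Proof.
move=> c0 c'0 hh' lh [B fB eB]; have h'h := mulmx1C hh'.
exists (B *m h') => [|x].
  rewrite /row_free mxrankMfree//; apply/row_freeP; by exists h.
rewrite !mulmxA -(mulmxA _ h') h'h mulmx1 mulrAC ler_pdivrMr//.
rewrite (le_trans _ (ler_wpM2r (ltW c'0) (eB x)))// -mulrA ler_wpM2l//.
by rewrite (le_trans (mxnormM _ _))// ler_wpM2l// mxnorm_ge0.
Qed.

Lemma contractingMr c c' g h : mxnorm h <= c' ->
  contracting c g -> contracting (c * c') (g *m h).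
Proof.
move=> lh [B fB eB]; exists B => // x; rewrite mulmxA.
rewrite (le_trans (mxnormM _ _))// mulrAC ler_pM ?mxnorm_ge0//.
Qed.

Lemma contractingMl c c' g h h' : 0 <= c -> h *m h' = 1%:M -> mxnorm h <= c' ->
  contracting c g -> contracting (c * c') (h *m g).
Proof.
move=> c0 hh' lh [B fB eB]; have h'h := mulmx1C hh'.
exists (B *m h') => [|x].
  rewrite /row_free mxrankMfree//; apply/row_freeP; by exists h.
rewrite !mulmxA -(mulmxA _ h') h'h mulmx1 (le_trans (eB x))// -mulrA ler_wpM2l//.
rewrite -[X in mxnorm X <= _]mulmx1 -h'h mulmxA mulrC.
by rewrite (le_trans (mxnormM _ _))// ler_wpM2l// mxnorm_ge0.
Qed.

Lemma expandingW c c' g : c' <= c -> expanding c g -> expanding c' g.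
Proof.
move=> cc [B fB eB]; exists B => // x; rewrite (le_trans _ (eB x))//.
by rewrite ler_wpM2r// mxnorm_ge0.
Qed.

Lemma coordinate_subspace (I : {set 'I_n}) : (d <= #|I|)%N ->
  exists2 B : 'M[K]_(d, n), row_free B &
    forall (x : 'rV_d) j, j \notin I -> (x *m B) 0 j = 0.
Proof.
move=> dI; pose f (k : 'I_d) := enum_val (widen_ord dI k).
have fI : injective f.
  by move=> k l /enum_val_inj /(congr1 val) /= e; apply/val_inj.
exists (rowsub f 1%:M).
  apply/row_freeP; exists (rowsub f 1%:M)^T; rewrite mul_rowsub_mx mul1mx.
  by apply/matrixP => k l; rewrite !mxE eq_sym (inj_eq fI).
move=> x j jI; rewrite mxE big1// => k _; rewrite !mxE; 
case: eqP => [e|]; last by rewrite mulr0.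
by rewrite -e enum_valP in jI.
Qed.

Lemma mxnorm_diag_ge (I : {set 'I_n}) (a y : 'rV[K]_n) (t : R) : 0 <= t ->
  (forall j, j \in I -> t <= absv (a 0 j)) -> (forall j, j \notin I -> y 0 j = 0) ->
  t * mxnorm y <= mxnorm (y *m diag_mx a).
Proof.
move=> t0 ta y0; rewrite /mxnorm !big_ord1 mulr_sumr; apply: ler_sum => j _.
rewrite mul_mx_diag mxE absvM mulrC.
have [jI|/y0->] := boolP (j \in I); last by rewrite absv0 !mul0r.
by rewrite ler_wpM2l ?absv_ge0// ta.
Qed.

Lemma mxnorm_diag_le (I : {set 'I_n}) (a y : 'rV[K]_n) (t : R) :
  (forall j, j \in I -> absv (a 0 j) <= t) -> (forall j, j \notin I -> y 0 j = 0) ->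
  mxnorm (y *m diag_mx a) <= t * mxnorm y.
Proof.
move=> ta y0; rewrite /mxnorm !big_ord1 mulr_sumr; apply: ler_sum => j _.
rewrite mul_mx_diag mxE absvM mulrC.
have [jI|/y0->] := boolP (j \in I); last by rewrite absv0 !mulr0.
by rewrite ler_wpM2r ?absv_ge0// ta.
Qed.

Lemma expanding_diag (I : {set 'I_n}) (a : 'rV[K]_n) (t c : R) u v :
  0 <= t -> 0 < c -> bounded_unit c u -> bounded_unit c v ->
  (d <= #|I|)%N -> (forall j, j \in I -> t <= absv (a 0 j)) ->
  expanding (t / c / c) (u *m diag_mx a *m v).
Proof.
move=> t0 c0 [u' [uu' uc u'c]] [v' [vv' vc v'c]] dI ta.
apply: (expandingMr (h' := v')) => //.
apply: (expandingMl (h' := u')) => //.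
have [B fB zB] := coordinate_subspace dI; exists B => // x.
by apply: mxnorm_diag_ge ta _ => //; apply: zB.
Qed.

Lemma contracting_diag (I : {set 'I_n}) (a : 'rV[K]_n) (t c : R) u v :
  0 <= t -> 0 < c -> bounded_unit c u -> bounded_unit c v ->
  (d <= #|I|)%N -> (forall j, j \in I -> absv (a 0 j) <= t) ->
  contracting (t * c * c) (u *m diag_mx a *m v).
Proof.
move=> t0 c0 [u' [uu' uc u'c]] [v' [vv' vc v'c]] dI ta.
apply: contractingMr => //.
apply: (contractingMl (h' := u')) => //.
have [B fB zB] := coordinate_subspace dI; exists B => // x.
by apply: mxnorm_diag_le ta _; apply: zB.
Qed.

(** If all pivots are very large or very small, then one of the two kinds
    occurs at least d times among the 2 d - 1 pivots, and the coordinate subspace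
    of these pivots is expanded or contracted. *)
Lemma expanding_or_contracting_or_middle : (d + d = n.+1)%N ->
  exists2 c : R, 0 < c & forall C : R, 0 < C -> exists2 T : R, 0 < T &
    forall g, [\/ expanding C g, contracting C^-1 g |
      exists u v (a : 'rV_n) i, [/\ bounded_unit c u, bounded_unit c v,
        g = u *m diag_mx a *m v, T^-1 < absv (a 0 i) & absv (a 0 i) < T]].
Proof.
move=> dn; have [c0 hc0] := bounded_diagonalization K n.
pose c := Num.max c0 1; have c_gt0 : 0 < c by rewrite lt_max ltr01 orbT.
exists c => // C C0; pose T := C * c * c.
have T0 : 0 < T by rewrite !mulr_gt0.
exists T => // g; have [u [v [a [bu bv gE]]]] := hc0 g.
have bW (w : 'M[K]_n) : bounded_unit c0 w -> bounded_unit c w.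
  by move=> [w' [? w1 w2]]; exists w'; split; rewrite // le_max ?w1 ?w2.
have {}bu := bW _ bu; have {}bv := bW _ bv.
pose I1 := [set j | T <= absv (a 0 j)]%SET.
pose I2 := [set j | absv (a 0 j) <= T^-1]%SET.
have [d1|d1] := leqP d #|I1|.
  constructor 1; have -> : C = T / c / c by rewrite /T !mulfK ?gt_eqF.
  rewrite gE; apply: (expanding_diag (I := I1)) => //; first exact: ltW.
  by move=> j; rewrite inE.
have [d2|d2] := leqP d #|I2|.
  constructor 2; have -> : C^-1 = T^-1 * c * c.
    by rewrite /T !invfM -!mulrA; field; rewrite !gt_eqF.
  rewrite gE; apply: (contracting_diag (I := I2)) => //.
    by rewrite invr_ge0 ltW.
  by move=> j; rewrite inE.
constructor 3; exists u, v, a.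
have lt : (#|(I1 :|: I2)%SET| < n)%N by have := cardsU I1 I2; lia.
have /subsetPn[i _] : ~~ ([set: 'I_n]%SET \subset (I1 :|: I2)%SET).
  by apply: contraL lt => /subset_leq_card; rewrite cardsT card_ord leqNgt.
rewrite !inE negb_or -!ltNge => /andP[i1 i2]; by exists i.
Qed.

End Expansion.

(** * Traces of elements of finite order, and the trace form of a finite group *)

Section TraceBound.
Variables (R : realType) (K : absValuedFieldType R) (n : nat).

Lemma det_le_mxnorm (P : 'M[K]_n) :
  absv (\det P) <= (#|{:{perm 'I_n}}|)%:R * \prod_i mxnorm (row i P) :> R.
Proof.
rewrite mulr_natl -sumr_const (le_trans (absv_sum _ _))//.
apply: ler_sum => s _; rewrite absvM absv_sign mul1r absv_prod.
apply: ler_prod => i _; rewrite absv_ge0/=.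
by rewrite (le_trans _ (absv_le_mxnorm _ 0 (s i)))// mxE.
Qed.

Definition replace_row (P : 'M[K]_n) i (v : 'rV_n) : 'M[K]_n :=
  \matrix_(k, l) if k == i then v 0 l else P k l.

Lemma det_replace_row P i v : \det (replace_row P i v) = (v *m \adj P) 0 i.
Proof.
rewrite (expand_det_row _ i) mxE; apply: eq_bigr => j _.
rewrite !mxE eqxx; congr (_ * (_ * _)); congr (\det _).
by apply/matrixP => k l; rewrite !mxE eq_sym (negPf (neq_lift _ _)).
Qed.

Lemma row_replace_row P i v k :
  row k (replace_row P i v) = if k == i then v else row k P.
Proof. by apply/rowP => l; rewrite !mxE; case: eqP => // _; rewrite mxE. Qed.

(** Choose a basis whose determinant, divided by the product of the nu-lengths
    of its vectors, is more than half of the supremum of these ratios. Let v be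
    the image under g of the i-th basis vector, so that it has the same nu-length.
    By Cramer's rule the i-th coordinate of v is the quotient of two
    determinants, of the basis in which v replaces the i-th vector and of the
    basis itself, hence at most 2. The trace is the sum of these coordinates. *)
Lemma trace_isometry (g : 'M[K]_n) (nu : 'rV[K]_n -> R) :
  (forall v, mxnorm v <= nu v) -> (forall v, nu (v *m g) = nu v) ->
  absv (\tr g) <= 2 * n%:R :> R.
Proof.
move=> le_nu nu_g.
pose w (P : 'M[K]_n) : R := \prod_i nu (row i P).
have nu0 v : 0 <= nu v by rewrite (le_trans _ (le_nu v))// mxnorm_ge0.
have w_ge0 (P : 'M[K]_n) : 0 <= w P by apply: prodr_ge0.
have w_gt0 (P : 'M[K]_n) : P \in unitmx -> 0 < w P.
  move=> uP; apply: prodr_gt0 => i _; rewrite (lt_le_trans _ (le_nu _))//.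
  rewrite lt_neqAle mxnorm_ge0 andbT eq_sym; apply/eqP => /mxnorm_eq0 r0.
  have : row i P *m invmx P = 0 by rewrite r0 mul0mx.
  rewrite -row_mul mulmxV// => /rowP/(_ i); rewrite !mxE eqxx => /eqP.
  by rewrite oner_eq0.
pose S : set R := [set r | exists2 P, P \in unitmx & r = absv (\det P) / w P].
have hS : has_sup S.
  split; first by exists (absv (\det (1%:M : 'M[K]_n)) / w 1%:M), 1%:M; rewrite ?unitmx1.
  exists (#|{:{perm 'I_n}}|)%:R => _ [P uP ->]; rewrite ler_pdivrMr ?w_gt0//.
  rewrite (le_trans (det_le_mxnorm P))// ler_wpM2l// ler_prod// => i _.
  by rewrite mxnorm_ge0 le_nu.
have leS (P : 'M[K]_n) : absv (\det P) <= sup S * w P.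
  have [uP|nuP] := boolP (P \in unitmx).
    by rewrite -ler_pdivrMr ?w_gt0//; apply: sup_upper_bound => //; exists P.
  rewrite unitmxE unitfE negbK in nuP; rewrite (eqP nuP) absv0 mulr_ge0//.
  have S1 : S (absv (\det (1%:M : 'M[K]_n)) / w 1%:M) by exists 1%:M; rewrite ?unitmx1.
  by rewrite (le_trans _ (sup_upper_bound hS S1))// divr_ge0// absv_ge0.
have s_gt0 : 0 < sup S.
  have := leS 1%:M; rewrite det1 absv1 => H.
  by rewrite -(pmulr_lgt0 _ (w_gt0 _ (unitmx1 _ _))) (lt_le_trans _ H).
have [_ [P uP ->] ltP] := @sup_adherent _ S (sup S / 2) (divr_gt0 s_gt0 (ltr0n _ 2)) hS.
have dP0 : 0 < absv (\det P) :> R.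
  by rewrite lt_neqAle eq_sym absv_eq0 absv_ge0 andbT -unitfE -unitmxE.
have diag i : absv ((P *m g *m invmx P) i i) <= 2 :> R.
  pose v := row i P *m g.
  have -> : (P *m g *m invmx P) i i = (\det P)^-1 * \det (replace_row P i v).
    rewrite det_replace_row /invmx uP -scalemxAr mxE; congr (_ * _).
    by rewrite /v -!row_mul [RHS]mxE.
  have wE : w (replace_row P i v) = w P.
    by apply: eq_bigr => k _; rewrite row_replace_row; case: eqP => // ->; apply: nu_g.
  rewrite absvM absvV ler_pdivrMl// (le_trans (leS _))// wE.
  have := ltW ltP; rewrite ler_pdivlMr ?w_gt0// => H.
  lra.
have -> : \tr g = \tr (P *m g *m invmx P).
  by rewrite mxtrace_mulC mulmxA mulVmx// mul1mx.
rewrite /mxtrace (le_trans (absv_sum _ _))//.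
apply: (le_trans (ler_sum _ (fun i _ => diag i))).
by rewrite sumr_const card_ord mulr_natr.
Qed.

End TraceBound.

Section TraceForm.
Variables (K : fieldType) (n : nat).
Hypothesis char0 : forall m, (0 < m)%N -> m%:R != 0 :> K.

(** The trace of an idempotent is its rank. *)
Lemma idempotent_trace_eq0 (e : 'M[K]_n) : e *m e = e -> \tr e = 0 -> e = 0.
Proof.
move=> ee te; have eE := mulmx_base e.
have BC : row_base e *m col_base e = 1%:M.
  have [B' BB'] := row_freeP (row_base_free e).
  have /row_fullP[C' CC'] := col_base_full e.
  have : C' *m (e *m e) *m B' = C' *m e *m B' by rewrite ee.
  move: (\rank e) (col_base e) (row_base e) eE B' BB' C' CC' => r C B <- B' BB' C' CC'.
  by rewrite !mulmxA CC' !mul1mx -!mulmxA BB' mulmx1.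
move: te; rewrite -[in LHS]eE mxtrace_mulC BC mxtrace1 => r0.
have [/eqP|/char0] := posnP (\rank e); first by rewrite mxrank_eq0 => /eqP ->.
by rewrite r0 eqxx.
Qed.

Section FiniteGroup.
Variables (I : finType) (s : I -> 'M[K]_n) (mul : I -> I -> I) (inv : I -> I) (one : I).
Hypothesis s1 : s one = 1%:M.
Hypothesis sM : forall i j, s (mul i j) = s i *m s j.
Hypothesis sV : forall i, s i *m s (inv i) = 1%:M.
Hypothesis mulI : forall j, injective (mul j).

Local Notation E := (<<codom s>>)%VS.

Lemma span_stable (x : 'M[K]_n) j u :
  (u \in <<[seq x *m s i | i : I]>> -> u *m s j \in <<[seq x *m s i | i : I]>>)%VS.
Proof.
set U := (<<_>>)%VS => uU.
have -> : u *m s j = linfun (mulmxr (s j)) u by rewrite lfunE.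
rewrite memv_preim; move: u uU; apply/subvP/span_subvP => _ /codomP[i ->].
rewrite -memv_preim lfunE/= -mulmxA -sM; apply: memv_span; exact: codom_f.
Qed.

(** Maschke averaging makes the projection onto the right ideal generated by x
    right linear, hence left multiplication by an idempotent of that ideal. The
    idempotent has trace zero, so it vanishes. *)
Lemma trace_form_nondegenerate (x : 'M[K]_n) :
  x \in E -> (forall j, \tr (x *m s j) = 0) -> x = 0.
Proof.
move=> xE trx; pose U := (<<[seq x *m s i | i : I]>>)%VS.
have Ust u j : u \in U -> u *m s j \in U by exact: span_stable.
have xU : x \in U by rewrite -[x]mulmx1 -s1; apply/memv_span/codom_f.
have trU u : u \in U -> \tr u = 0.
  have : (U <= lker (linfun (mxtrace : 'M[K]_n -> K^o)))%VS.
    by apply/span_subvP => _ /codomP[i ->]; rewrite memv_ker lfunE/= trx.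
  by move=> /subvP H /H; rewrite memv_ker lfunE => /eqP.
have UE : (U <= E)%VS.
  apply/span_subvP => _ /codomP[j ->].
  have EE : E = (<<[seq 1%:M *m s i | i : I]>>)%VS.
    by congr span; apply: eq_codom => i; rewrite mul1mx.
  by rewrite EE; apply: span_stable; rewrite -EE.
pose F : 'End('M[K]_n) :=
  \sum_i (linfun (mulmxr (s (inv i))) \o projv U \o linfun (mulmxr (s i)))%VF.
have FE y : F y = \sum_i projv U (y *m s i) *m s (inv i).
  by rewrite sum_lfunE; apply: eq_bigr => i _; rewrite !comp_lfunE !lfunE.
have FU y : F y \in U by rewrite FE; apply: memv_suml => i _; apply/Ust/memv_proj.
pose c : K := #|I|%:R.
have c0 : c != 0 by apply: char0; rewrite -cardsT card_gt0; apply/set0Pn; exists one.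
have Fid u : u \in U -> F u = c *: u.
  move=> uU; rewrite FE (eq_bigr (fun=> u)) => [|i _].
    by rewrite sumr_const scaler_nat.
  by rewrite projv_id ?Ust// -mulmxA sV mulmx1.
have FM y j : F (y *m s j) = F y *m s j.
  rewrite !FE mulmx_suml [RHS](reindex_inj (mulI (j := j)))/=.
  apply: eq_bigr => i _; rewrite -!mulmxA -sM; congr (_ *m _).
  have := sV (mul j i); rewrite sM => /mulmx1C; rewrite mulmxA => e.
  by rewrite -[LHS]mul1mx -e -!mulmxA sV mulmx1.
have FE' y : y \in E -> F y = F 1%:M *m y.
  move=> yE; have : (E <= lker (F - linfun (mulmx (F 1%:M))))%VS.
    apply/span_subvP => _ /codomP[j ->].
    by rewrite memv_ker add_lfunE opp_lfunE lfunE/= -FM mul1mx subrr.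
  by move=> /subvP /(_ _ yE); rewrite memv_ker add_lfunE opp_lfunE lfunE/= subr_eq0 => /eqP.
pose e := c^-1 *: F 1%:M.
have eU : e \in U by rewrite memvZ.
have e_id u : u \in U -> e *m u = u.
  move=> uU; rewrite -scalemxAl -FE'; last exact: (subvP UE).
  by rewrite Fid// scalerA mulVf// scale1r.
have e0 : e = 0 by apply: idempotent_trace_eq0; [exact: e_id|exact: trU].
by rewrite -(e_id x xU) e0 mul0mx.
Qed.

End FiniteGroup.
End TraceForm.

(** * Torsion linear groups are bounded *)

Section BoundedByTraces.
Variables (R : realType) (K : absValuedFieldType R) (n : nat).
Hypothesis char0 : forall m, (0 < m)%N -> m%:R != 0 :> K.
Variables (I : finType) (s : I -> 'M[K]_n) (mul : I -> I -> I) (inv : I -> I) (one : I).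
Hypothesis s1 : s one = 1%:M.
Hypothesis sM : forall i j, s (mul i j) = s i *m s j.
Hypothesis sV : forall i, s i *m s (inv i) = 1%:M.
Hypothesis mulI : forall j, injective (mul j).

Lemma span_codomP (y : 'M[K]_n) : y \in <<codom s>>%VS ->
  exists c : 'rV[K]_#|I|, y = \sum_i c 0 i *: s (enum_val i).
Proof.
have /eqP sz : size (codom s) = #|I| by rewrite size_codom.
move=> /(@coord_span _ _ _ (Tuple sz)) ->.
exists (\row_i coord (Tuple sz) i y); apply: eq_bigr => i _.
by rewrite mxE /= (nth_codom 0).
Qed.

(** As the trace form is nondegenerate on the span of the s i, the matrix S whose
    rows are the s i factors through their Gram matrix G, and an element y of the
    span is a fixed linear image of its vector of traces against the s i. *)
Lemma mxnorm_bounded_by_traces (b : R) : exists c : R, forall y : 'M[K]_n,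
  y \in <<codom s>>%VS -> (forall j, absv (\tr (y *m s j)) <= b) -> mxnorm y <= c.
Proof.
pose m := #|I|; pose t (i : 'I_m) := s (enum_val i).
pose G : 'M[K]_m := \matrix_(i, j) \tr (t i *m t j).
pose S : 'M[K]_(m, n * n) := \matrix_i mxvec (t i).
have cS (c : 'rV_m) : c *m S = mxvec (\sum_i c 0 i *: t i).
  rewrite linear_sum mulmx_sum_row; apply: eq_bigr => i _.
  by rewrite linearZ/= rowK.
have cG (c : 'rV_m) j : (c *m G) 0 j = \tr ((\sum_i c 0 i *: t i) *m t j).
  rewrite mulmx_suml linear_sum mxE; apply: eq_bigr => i _.
  by rewrite mxE -scalemxAl linearZ.
have kerGS : kermx G *m S = 0.
  apply/row_matrixP => k; rewrite row_mul row0 cS.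
  rewrite -[RHS](linear0 (mxvec : 'M[K]_n -> _)); congr mxvec.
  apply: (trace_form_nondegenerate char0 s1 sM sV mulI).
    by apply: memv_suml => i _; apply/memvZ/memv_span/codom_f.
  move=> j; have := cG (row k (kermx G)) (enum_rank j).
  rewrite /t enum_rankK => <-.
  by rewrite -row_mul mulmx_ker row0 mxE.
have SE : S = G *m (pinvmx G *m S).
  apply/eqP; rewrite mulmxA -subr_eq0 -{1}[S]mul1mx -mulmxBl; apply/eqP.
  have /submxP[D ->] : (1%:M - G *m pinvmx G <= kermx G)%MS.
    by apply/sub_kermxP; rewrite mulmxBl mul1mx mulmxKpV ?subrr.
  by rewrite -mulmxA kerGS mulmx0.
set T := pinvmx G *m S in SE.
exists ((b *+ m *+ 1 * mxnorm T) *+ n *+ n) => y /span_codomP[c yE] try.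
have yT : mxvec y = (c *m G) *m T by rewrite -mulmxA -SE cS -yE.
have cGb : mxnorm (c *m G) <= b *+ m *+ 1.
  by apply: mxnorm_le_const => k j; rewrite [k]ord1 cG -yE; apply: try.
apply: mxnorm_le_const => i j.
rewrite -mxvecE yT (le_trans (absv_le_mxnorm _ _ _))//.
by rewrite (le_trans (mxnormM _ _))// ler_wpM2r// mxnorm_ge0.
Qed.

End BoundedByTraces.

Section TorsionGroups.
Variables (R : realType) (K : absValuedFieldType R) (n : nat).
Hypothesis char0 : forall m, (0 < m)%N -> m%:R != 0 :> K.
Local Notation G := (SL K n).

Lemma SL_valM (x y : G) : sval (x * y)%g = sval x *m sval y.
Proof. by []. Qed.

Lemma SL_val1 : sval (1%g : G) = 1%:M.
Proof. by []. Qed.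

Lemma SL_valV (x : G) : sval x *m sval (x^-1)%g = 1%:M.
Proof. by rewrite -SL_valM mulgV. Qed.

(** The sum nu of the norms of the v g^i over a period is invariant under g. *)
Lemma trace_torsion (g : G) m : (0 < m)%N -> (g ^+ m)%g = 1%g ->
  absv (\tr (sval g)) <= 2 * n%:R :> R.
Proof.
case: m => // m _ gm.
pose nu (v : 'rV[K]_n) : R := \sum_(i < m.+1) mxnorm (v *m sval (g ^+ i)%g).
apply: (trace_isometry (nu := nu)) => v.
  rewrite /nu big_ord_recl expg0 SL_val1 mulmx1 ler_wpDr// sumr_ge0// => i _.
  exact: mxnorm_ge0.
rewrite /nu big_ord_recr [RHS]big_ord_recl/= addrC; congr (_ + _).
  by rewrite -mulmxA -SL_valM -expgS gm.
by apply: eq_bigr => i _; rewrite -mulmxA -SL_valM -expgS.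
Qed.

(** Finitely many elements of Gam of maximal rank span the same space as Gam.
    They generate a finite subgroup, and testing the traces against it bounds all
    of Gam. *)
Lemma torsion_bounded (Gam : set G) :
  Gam 1%g -> (forall x y, Gam x -> Gam y -> Gam (x * y)%g) ->
  (forall x, Gam x -> Gam x^-1%g) ->
  (forall g, Gam g -> exists2 m, (0 < m)%N & (g ^+ m)%g = 1%g) ->
  (forall S, finite_set S -> (forall s, S s -> S s^-1%g) -> S `<=` Gam ->
     finite_set (gen_words S)) ->
  exists c : R, forall g, Gam g -> mxnorm (sval g) <= c.
Proof.
move=> G1 GM GV tors lf.
pose P d := `[< exists l : seq G, (forall g, g \in l -> Gam g) /\
  \dim <<map sval l>>%VS = d >].
have exP : exists d, P d.
  by exists (\dim <<map sval ([::] : seq G)>>%VS); apply/asboolP; exists [::].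
have bP d : P d -> (d <= \dim {:'M[K]_n})%N.
  by move=> /asboolP[l [_ <-]]; exact: dimvS (subvf _).
case: (ex_maxnP exP bP) => d /asboolP[l [lG dl]] dmax.
have spanl g : Gam g -> sval g \in <<map sval l>>%VS.
  move=> Gg; have /dmax : P (\dim <<map sval (g :: l)>>%VS).
    apply/asboolP; exists (g :: l); split=> // h; rewrite inE => /orP[/eqP->//|]; exact: lG.
  rewrite -dl /= => le_dim.
  have sub : (<<map sval l>> <= <<sval g :: map sval l>>)%VS.
    by apply: sub_span => x xl; rewrite inE xl orbT.
  have /eqP -> : (<<map sval l>> == <<sval g :: map sval l>>)%VS.
    by rewrite eqEdim sub.
  by apply: memv_span; rewrite inE eqxx.
pose S : set G := [set g | g \in l \/ (g^-1)%g \in l].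
have SG : S `<=` Gam by move=> g [/lG//|/lG /GV]; rewrite invgK.
have SV x : S x -> S x^-1%g by move=> [?|?]; [right|left]; rewrite ?invgK.
have finS : finite_set S.
  have -> : S = [set` l] `|` ((fun g => g^-1)%g @^-1` [set` l]) by [].
  rewrite finite_setU; split; first exact: finite_seq.
  by apply: finite_preimage; [move=> a b _ _ /invg_inj|exact: finite_seq].
have /finite_fsetP[X XE] := lf S finS SV SG.
have XP g : (g \in X) <-> gen_words S g by rewrite XE.
have LG g : g \in X -> Gam g.
  by move=> /XP; apply: (gen_words_subgroup G1 GM).
have X1 : (1%g : G) \in X by apply/XP; exact: gen_words1.
have XM (x y : X) : (val x * val y)%g \in X.
  by apply/XP; apply: gen_wordsM; apply/XP; apply: valP.
have XV (x : X) : ((val x)^-1)%g \in X.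
  by apply/XP; apply: gen_wordsV => //; apply/XP; apply: valP.
have mulI (x : X) : injective (fun y : X => FSetSub (XM x y)).
  by move=> y z /(congr1 val)/= /mulgI /val_inj.
have [c hc] := @mxnorm_bounded_by_traces R K n char0 X (fun x : X => sval (val x))
   (fun x y => FSetSub (XM x y)) (fun x => FSetSub (XV x)) (FSetSub X1) erefl
   (fun _ _ => erefl) (fun x => SL_valV (val x)) mulI (2 * n%:R).
exists c => g Gg; apply: hc.
  have /subvP : (<<map sval l>> <= <<codom (fun x : X => sval (val x))>>)%VS.
    apply: sub_span => _ /mapP[x xl ->].
    have xX : x \in X by apply/XP; apply: gen_words_sub; left.
    by apply/codomP; exists (FSetSub xX).
  by apply; exact: spanl.
move=> x; have [m m0 e] := tors _ (GM _ _ Gg (LG _ (valP x))).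
exact: (trace_torsion m0 e).
Qed.

End TorsionGroups.

(** * The corner subgroup and elements with a bounded middle pivot *)

Section CornerSubgroup.
Variables (K : fieldType) (n : nat).
Implicit Types A B : 'M[K]_n.

Lemma corner_mx_lift A i j :
  @corner_mx K n.+1 A (lift ord_max i) (lift ord_max j) = A i j.
Proof.
rewrite mxE !lift_max (insubT (fun x => x < n)%N (ltn_ord i)).
rewrite (insubT (fun x => x < n)%N (ltn_ord j)) /=.
by congr (A _ _); apply/val_inj.
Qed.

Lemma corner_mx_maxl A j : @corner_mx K n.+1 A ord_max j = (ord_max == j)%:R.
Proof. by rewrite mxE insubF ?ltnn. Qed.

Lemma corner_mx_maxr A i : @corner_mx K n.+1 A i ord_max = (i == ord_max)%:R.
Proof.
rewrite mxE; have -> : insub (nat_of_ord (@ord_max n)) = None :> option 'I_n.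
  by rewrite insubF ?ltnn.
by case: insub.
Qed.

Lemma corner_mxM A B :
  @corner_mx K n.+1 (A *m B) = @corner_mx K n.+1 A *m @corner_mx K n.+1 B.
Proof.
apply/matrixP => i j; rewrite [RHS]mxE (bigD1_ord ord_max)//=.
have [i'|] := unliftP ord_max i; last first.
  move=> ->; rewrite !corner_mx_maxl eqxx mul1r big1 ?addr0// => k _.
  by rewrite corner_mx_maxl (negPf (neq_lift _ _)) mul0r.
move=> ->; rewrite corner_mx_maxr eq_sym (negPf (neq_lift _ _)) mul0r add0r.
have [j'|] := unliftP ord_max j => ->.
  by rewrite corner_mx_lift mxE; apply: eq_bigr => k _; rewrite !corner_mx_lift.
rewrite corner_mx_maxr eq_sym (negPf (neq_lift _ _)) big1// => k _.
by rewrite corner_mx_maxr eq_sym (negPf (neq_lift _ _)) mulr0.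
Qed.

Lemma corner_mx1 : @corner_mx K n.+1 1%:M = 1%:M.
Proof.
apply/matrixP => i j.
have [i'|] := unliftP ord_max i => ->; last by rewrite corner_mx_maxl mxE.
have [j'|] := unliftP ord_max j => ->; last by rewrite corner_mx_maxr mxE.
by rewrite corner_mx_lift !mxE (inj_eq lift_inj).
Qed.

Lemma SL_cornerM (g h : SL K n.+1) :
  SL_corner K n.+1 g -> SL_corner K n.+1 h -> SL_corner K n.+1 (g * h)%g.
Proof.
move=> [a ga] [b hb]; exists (SL_mul a b).
by rewrite /= corner_mxM -ga -hb.
Qed.

Lemma SL_cornerV (g : SL K n.+1) : SL_corner K n.+1 g -> SL_corner K n.+1 g^-1%g.
Proof.
move=> [a ga]; exists (SL_inv a).
rewrite -[LHS]mulmx1 -corner_mx1 -(mulmxV (SL_unitmx a)) corner_mxM -ga mulmxA.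
by rewrite /= mulVmx ?mul1mx// SL_unitmx.
Qed.

Lemma left_coset_corner (g h : SL K n.+1) : SL_corner K n.+1 h ->
  left_coset (SL_corner K n.+1) (g * h)%g = left_coset (SL_corner K n.+1) g.
Proof.
move=> Hh; apply/seteqP; split=> _ [x Hx <-].
  by exists (h * x)%g; rewrite ?mulgA//; exact: SL_cornerM.
exists (h^-1 * x)%g; first by apply: SL_cornerM => //; exact: SL_cornerV.
by rewrite -mulgA mulVKg.
Qed.

Lemma corner_diag (b : 'rV[K]_n.+1) : b 0 ord_max = 1 ->
  diag_mx b = @corner_mx K n.+1 (diag_mx (\row_j b 0 (lift ord_max j))).
Proof.
move=> b1; apply/matrixP => i j.
have [i'|] := unliftP ord_max i => ->; last first.
  by rewrite corner_mx_maxl !mxE b1; case: eqP.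
have [j'|] := unliftP ord_max j => ->; last first.
  by rewrite corner_mx_maxr !mxE eq_sym; case: eqP => // <-; rewrite b1.
by rewrite corner_mx_lift !mxE (inj_eq lift_inj).
Qed.

End CornerSubgroup.

Section MiddleFactor.
Variables (R : realType) (K : absValuedFieldType R).

Definition bounded_SL n (c : R) : set (SL K n) := [set g | bounded_unit c (sval g)].

Lemma bounded_unitW n (c c' : R) (u : 'M[K]_n) :
  c <= c' -> bounded_unit c u -> bounded_unit c' u.
Proof. by move=> cc [w [? u1 w1]]; exists w; split=> //; exact: le_trans cc. Qed.

Lemma bounded_unit_diag n (a : 'rV[K]_n) (b : R) :
  (forall j, [/\ a 0 j != 0, absv (a 0 j) <= b & absv (a 0 j)^-1 <= b]) -> 0 <= b ->
  bounded_unit (b *+ n *+ n) (diag_mx a).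
Proof.
move=> ab b0; exists (diag_mx (\row_j (a 0 j)^-1)); split.
- rewrite mulmx_diag -diag_const_mx; congr diag_mx.
  by apply/rowP => j; rewrite !mxE divff//; case: (ab j).
- apply: mxnorm_le_const => i j; rewrite mxE.
  by case: eqP => _; rewrite ?mulr0n ?absv0// mulr1n; case: (ab i) => // ; case: (ab j).
- apply: mxnorm_le_const => i j; rewrite !mxE.
  by case: eqP => _; rewrite ?mulr0n ?absv0// mulr1n; case: (ab j); case: (ab i).
Qed.

Lemma absv_det_le n (u : 'M[K]_n) c : mxnorm u <= c ->
  absv (\det u) <= (#|{:{perm 'I_n}}|)%:R * c ^+ n :> R.
Proof.
move=> uc; rewrite (le_trans (det_le_mxnorm u))// ler_wpM2l//.
rewrite -[n in c ^+ n]card_ord -prodr_const ler_prod// => i _.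
rewrite mxnorm_ge0/= (le_trans _ uc)// /mxnorm big_ord1 [leRHS](bigD1 i)//=.
rewrite ler_wpDr//; last by apply: ler_sum => j _; rewrite mxE.
by apply: sumr_ge0 => k _; apply: sumr_ge0 => j _; apply: absv_ge0.
Qed.

Section Factor.
Variable n : nat.
Local Notation N := n.+2.

Definition end_diag (x y : K) : 'rV[K]_N :=
  \row_j if j == ord0 then x else if j == ord_max then y else 1.

Lemma det_end_diag x y : \det (diag_mx (end_diag x y)) = x * y.
Proof.
rewrite det_diag (bigD1 ord0)//= (bigD1 ord_max)//= !mxE !eqxx/= mulrA big1 ?mulr1//.
by move=> i /andP[i0 i1]; rewrite mxE (negPf i0) (negPf i1).
Qed.

(** A middle pivot of bounded size can be moved to the last position and
    absorbed, together with the determinants, in the bounded factors. *)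
Lemma middle_factor (c T : R) : 0 < T -> exists c' : R, forall g : SL K N,
  (exists u v (a : 'rV_N) i, [/\ bounded_unit c u, bounded_unit c v,
    sval g = u *m diag_mx a *m v, T^-1 < absv (a 0 i) & absv (a 0 i) < T]) ->
  exists x h y, [/\ bounded_SL c' x, SL_corner K N h, bounded_SL c' y &
    g = (x * h * y)%g].
Proof.
move=> T0; pose D : R := (#|{:{perm 'I_N}}|)%:R * c ^+ N.
pose b := Num.max 1 (Num.max D (Num.max T (D * T))).
pose t : R := 1 *+ N *+ N.
exists (Num.max (c * t * (b *+ N *+ N)) (b *+ N *+ N * t * c)).
move=> g [u [v [a [i [bu bv gE Ti iT]]]]].
have [u' [uu' uc u'c]] := bu; have [v' [vv' vc v'c]] := bv.
pose P : 'M[K]_N := tperm_mx i ord_max.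
have PP : P *m P = 1%:M by rewrite -perm_mxM tperm2 perm_mx1.
pose e := \det u; pose f := \det v; pose p := \det P; pose s := a 0 i.
have ee : e * \det u' = 1 by rewrite -det_mulmx uu' det1.
have ff : f * \det v' = 1 by rewrite -det_mulmx vv' det1.
have pp : p * p = 1 by rewrite -det_mulmx PP det1.
have nz (x y : K) : x * y = 1 -> x != 0.
  by move=> xy; apply: contra_eq_neq xy => ->; rewrite mul0r eq_sym oner_neq0.
have e0 := nz _ _ ee; have f0 := nz _ _ ff; have p0 := nz _ _ pp.
have Tinv : 0 < T^-1 by rewrite invr_gt0.
have s0 : s != 0 by rewrite -(absv_eq0 (s := K)) gt_eqF// (lt_trans Tinv).
have absp : absv p = 1 :> R by rewrite /p det_perm absv_sign.
have eD : absv e <= D :> R by apply: absv_det_le.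
have fD : absv f <= D :> R by apply: absv_det_le.
have eVD : absv e^-1 <= D :> R.
  have -> : e^-1 = \det u' by apply: (mulfI e0); rewrite ee divff.
  exact: absv_det_le.
have fVD : absv f^-1 <= D :> R.
  have -> : f^-1 = \det v' by apply: (mulfI f0); rewrite ff divff.
  exact: absv_det_le.
have D0 : 0 <= D by apply: le_trans eD; exact: absv_ge0.
have sVT : absv s^-1 <= T :> R.
  by rewrite absvV invf_ple ?posrE// ?ltW// (lt_trans Tinv).
have sT := ltW iT.
pose beta := (p * f)^-1; pose gam := p / (e * s).
have b1 : 1 <= b by rewrite /b le_max lexx.
have bD : D <= b by rewrite /b !le_max lexx orbT.
have bT : T <= b by rewrite /b !le_max lexx !orbT.
have bDT : D * T <= b by rewrite /b !le_max lexx !orbT.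
have b0 : 0 <= b by apply: le_trans b1.
have beta0 : beta != 0 by rewrite invr_eq0 mulf_neq0.
have gam0 : gam != 0 by rewrite mulf_neq0// invr_eq0 mulf_neq0.
pose D2 := diag_mx (end_diag gam s); pose D3 := diag_mx (end_diag beta 1).
have bD2 : bounded_unit (b *+ N *+ N) D2.
  apply: bounded_unit_diag => // j; rewrite mxE; case: ifP => _; last case: ifP => _.
  - split=> //.
      rewrite (le_trans _ bDT)// absvM absp mul1r invfM absvM.
      by rewrite ler_pM// absv_ge0.
    rewrite (le_trans _ bDT)// invf_div absvM absvV absp invr1 mulr1 absvM.
    by rewrite ler_pM// absv_ge0.
  - by split=> //; [exact: le_trans bT|exact: le_trans bT].
  - by rewrite oner_neq0 invr1 absv1.
have bD3 : bounded_unit (b *+ N *+ N) D3.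
  apply: bounded_unit_diag => // j; rewrite mxE; case: ifP => _; last case: ifP => _.
  - split=> //; rewrite (le_trans _ bD)//.
      by rewrite /beta invfM absvM absvV absp invr1 mul1r.
    by rewrite /beta invrK absvM absp mul1r.
  - by rewrite oner_neq0 invr1 absv1.
  - by rewrite oner_neq0 invr1 absv1.
have bP : bounded_unit t P by exact: bounded_unit_tperm.
pose a' : 'rV[K]_N := \row_j a 0 (tperm i ord_max j).
have PaP : P *m diag_mx a' *m P = diag_mx a.
  have -> : P *m diag_mx a' = diag_mx a *m P.
    apply/matrixP => k l; rewrite mul_mx_diag mul_diag_mx !mxE.
    by case: eqP => [<-|]; rewrite ?tpermK ?mulr1 ?mul1r ?mulr0 ?mul0r.
  by rewrite -mulmxA PP mulmx1.
pose z : 'rV[K]_N := \row_j if j == ord0 then a' 0 ord0 / (beta * gam)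
                        else if j == ord_max then 1 else a' 0 j.
have zE : D2 *m diag_mx z *m D3 = diag_mx a'.
  rewrite !mulmx_diag; congr diag_mx; apply/rowP => j; rewrite !mxE.
  case: eqP => [->|_]; first by field; rewrite beta0 gam0.
  by case: eqP => [->|_]; rewrite ?mul1r mulr1 ?mulr1 // tpermR.
have gamE : e * p * (gam * s) = 1.
  by rewrite -pp /gam; field; rewrite e0 s0.
have detz : \det (diag_mx z) = 1.
  have : \det (sval g) = 1 by exact/eqP/(svalP g).
  rewrite gE -PaP -zE !det_mulmx !det_end_diag -/e -/f -/p => H.
  have E1 : e * p * (gam * s) * (p * f * beta) * \det (diag_mx z) = 1.
    by rewrite -H; ring.
  by move: E1; rewrite gamE mul1r /beta divff ?mul1r// mulf_neq0.
have xdet : \det (u *m P *m D2) == 1.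
  by rewrite !det_mulmx det_end_diag -/e -/p gamE.
have ydet : \det (D3 *m P *m v) == 1.
  by rewrite !det_mulmx det_end_diag mulr1 -/f -/p /beta -mulrA mulVf// mulf_neq0.
have hdet : \det (diag_mx z) == 1 by exact/eqP.
exists (exist (fun M => \det M == 1) _ xdet : SL K N),
       (exist (fun M => \det M == 1) _ hdet : SL K N),
       (exist (fun M => \det M == 1) _ ydet : SL K N); split.
- apply: (bounded_unitW (c := c * t * (b *+ N *+ N))); first by rewrite le_max lexx.
  by apply: bounded_unitM => //; exact: bounded_unitM.
- have z1 : z 0 ord_max = 1 by rewrite mxE eqxx.
  have h'det : \det (diag_mx (\row_j z 0 (lift ord_max j)) : 'M[K]_n.+1) == 1.
    have prod_lift (w : 'rV[K]_N) : w 0 ord_max = 1 ->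
        \prod_j w 0 (lift ord_max j) = \prod_j w 0 j.
      by move=> w1; rewrite [RHS](bigD1_ord ord_max)//= w1 mul1r.
    apply/eqP; move: detz; rewrite !det_diag -(prod_lift z z1) => detz.
    by rewrite -[RHS]detz; apply: eq_bigr => j _; rewrite mxE.
  exists (exist (fun M => \det M == 1) _ h'det : SL K n.+1).
  exact: corner_diag.
- apply: (bounded_unitW (c := b *+ N *+ N * t * c)); first by rewrite le_max lexx orbT.
  by apply: bounded_unitM => //; exact: bounded_unitM.
- apply/val_inj; rewrite /= gE -PaP -zE.
  by rewrite !mulmxA.
Qed.

End Factor.
End MiddleFactor.

(** * Compact sets of matrices *)

Section Limits.
Variables (R : realType) (K : absValuedFieldType R).
Variables (T : Type) (F : set_system T).
Hypothesis FF : ProperFilter F.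
Implicit Types (f g : T -> K) (l m : K).

(** Convergence along F, by explicit estimates: the metric space
    [absv_space K] carries no algebraic structure compatible with its topology. *)
Definition absv_lim f l := forall e : R, 0 < e -> F [set t | absv (f t - l) < e].

Lemma absv_lim_cst l : absv_lim (fun=> l) l.
Proof. by move=> e e0; apply: filterE => t; rewrite /= subrr absv0. Qed.

Lemma absv_limD f g l m : absv_lim f l -> absv_lim g m ->
  absv_lim (fun t => f t + g t) (l + m).
Proof.
move=> fl gm e e0; have e2 : 0 < e / 2 by rewrite divr_gt0.
apply: filterS2 (fl _ e2) (gm _ e2) => t /= ft gt.
rewrite opprD addrACA (le_lt_trans (absvD _ _))// [e]splitr.
exact: ltrD.
Qed.

Lemma absv_limM f g l m : absv_lim f l -> absv_lim g m ->
  absv_lim (fun t => f t * g t) (l * m).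
Proof.
move=> fl gm e e0; pose M : R := 1 + absv l + absv m.
have M0 : 0 < M.
  by have := absv_ge0 (s := K) l; have := absv_ge0 (s := K) m; rewrite /M; lra.
pose d := Num.min 1 (e / M).
have d0 : 0 < d by rewrite lt_min ltr01 divr_gt0.
have d1 : d <= 1 by rewrite ge_min lexx.
have dM : d * M <= e by rewrite -ler_pdivlMr// ge_min lexx orbT.
apply: filterS2 (fl _ d0) (gm _ d0) => t /=; set x := f t; set y := g t => xl ym.
have -> : x * y - l * m = (x - l) * (y - m) + ((x - l) * m + l * (y - m)) by ring.
rewrite (lt_le_trans _ dM)// (le_lt_trans (absvD _ _))//.
apply: (@le_lt_trans _ _ (absv (x - l) * absv (y - m) +
    (absv (x - l) * absv m + absv l * absv (y - m)))).
  by rewrite absvM lerD2l (le_trans (absvD _ _))// !absvM.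
have a0 := absv_ge0 (s := K) (x - l); have b0 := absv_ge0 (s := K) (y - m).
have h1 : absv (x - l) * absv (y - m) < d.
  rewrite (le_lt_trans _ xl)// ler_piMr// (le_trans (ltW ym))//.
have h2 : absv (x - l) * absv m <= d * absv m :> R.
  by rewrite ler_wpM2r ?absv_ge0// ltW.
have h3 : absv l * absv (y - m) <= d * absv l :> R.
  by rewrite mulrC ler_wpM2r ?absv_ge0// ltW.
have : d * M = d + d * absv l + d * absv m by rewrite /M; ring.
lra.
Qed.

Lemma absv_lim_sum (I : finType) (f : I -> T -> K) (l : I -> K) :
  (forall i, absv_lim (f i) (l i)) -> absv_lim (fun t => \sum_i f i t) (\sum_i l i).
Proof.
move=> fl; rewrite -[X in absv_lim X](_ : (\sum_i (f i : T -> K)) = _); last first.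
  by apply/funext => t; rewrite fct_sumE.
elim/big_rec2: _ => [|i y x _ xy]; first exact: absv_lim_cst.
by apply: (absv_limD (f := f i)).
Qed.

Lemma absv_lim_prod (I : finType) (f : I -> T -> K) (l : I -> K) :
  (forall i, absv_lim (f i) (l i)) -> absv_lim (fun t => \prod_i f i t) (\prod_i l i).
Proof.
move=> fl; rewrite -[X in absv_lim X](_ : (\prod_i (f i : T -> K)) = _); last first.
  by apply/funext => t; rewrite fct_prodE.
elim/big_rec2: _ => [|i y x _ xy]; first exact: absv_lim_cst.
by apply: (absv_limM (f := f i)).
Qed.

Lemma absv_lim_unique f l m : absv_lim f l -> absv_lim f m -> l = m.
Proof.
move=> fl fm; apply/eqP; rewrite -subr_eq0 -(absv_eq0 (s := K)); apply/eqP/le_anti.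
rewrite absv_ge0 andbT leNgt; apply/negP => lm.
have e0 : 0 < absv (l - m) / 2 :> R by rewrite divr_gt0.
have [t [/= t1 t2]] := filter_ex (filterI (fl _ e0) (fm _ e0)).
have : absv (l - m) < absv (l - m) :> R; last by rewrite ltxx.
have e : l - m = (f t - m) - (f t - l) by ring.
rewrite {1}e [ltRHS]splitr (le_lt_trans (absvD _ _))// absvN.
by rewrite addrC; exact: ltrD.
Qed.

Lemma absv_lim_det n (A : T -> 'M[K]_n) (L : 'M[K]_n) :
  (forall i j, absv_lim (fun t => A t i j) (L i j)) ->
  absv_lim (fun t => \det (A t)) (\det L).
Proof.
move=> AL; apply: absv_lim_sum => s; apply: absv_limM; first exact: absv_lim_cst.
by apply: absv_lim_prod => i; apply: AL.
Qed.

End Limits.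

Section Compactness.
Variables (R : realType) (K : absValuedFieldType R).

Definition heine_borel := forall c : R,
  compact ([set x | absv x <= c] : set (absv_space K)).

Lemma nbhs_absv_space (x : absv_space K) (A : set (absv_space K)) :
  nbhs x A <-> exists2 e : R, 0 < e & [set y : K | absv ((y : K) - x) < e] `<=` A.
Proof.
rewrite -nbhs_ballE; split=> -[e e0 sA]; exists e => // y; move: (sA y).
  by rewrite ballEmdist/= /mdist/= absv_dist_sym.
by rewrite ballEmdist/= /mdist/= absv_dist_sym.
Qed.

(** A cluster point of the image of an ultrafilter is a limit. *)
Lemma ultra_absv_lim (T : Type) (F : set_system T) (f : T -> K) c : heine_borel ->
  UltraFilter F -> F [set t | absv (f t) <= c] -> exists l, absv_lim F f l.
Proof.
move=> hb UF Fc.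
have [l [_ cl]] := hb c ((f : T -> absv_space K) @ F) _ Fc.
exists l => e e0; have [//|nF] := in_ultra_setVsetC [set t | absv (f t - l) < e] UF.
have nl : nbhs (l : absv_space K) [set y : K | absv (y - l) < e].
  by apply/nbhs_absv_space; exists e.
have [_ [/= [t nt <-] xl]] :=
  cl (f @` ~` [set t | absv (f t - l) < e]) _
    (filterS (@preimage_image _ _ f _) nF) nl.
by case: (nt xl).
Qed.

(** Along an ultrafilter the entries converge, and so does the determinant, hence
    the limit matrix is in SL_n. *)
Lemma compact_entries_bounded n (c : R) : heine_borel ->
  compact [set g : SL K n | forall i j, absv (sval g i j) <= c].
Proof.
move=> hb; rewrite compact_ultra => F UF FA.
have /choice[L hL] : forall ij : 'I_n * 'I_n, exists l,
    absv_lim F (fun g => sval g ij.1 ij.2) l.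
  by move=> ij; apply: (ultra_absv_lim (c := c)) => //; apply: filterS FA => g /=.
pose M : 'M[K]_n := \matrix_(i, j) L (i, j).
have limM i j : absv_lim F (fun g => sval g i j) (M i j).
  by rewrite mxE; apply: (hL (i, j)).
have detM : \det M == 1.
  apply/eqP; apply: (@absv_lim_unique R K _ F _ (fun g : SL K n => \det (sval g))).
    exact: absv_lim_det.
  by move=> e e0; apply: filterE => g /=; rewrite (eqP (svalP g)) subrr absv0.
exists (exist (fun M => \det M == 1) M detM : SL K n); split=> /= [i j|].
  rewrite leNgt; apply/negP => cM.
  have e0 : 0 < absv (M i j) - c by rewrite subr_gt0.
  have [g [/= gA gM]] := filter_ex (filterI FA (limM i j _ e0)).
  have := absvD (s := K) (M i j - sval g i j) (sval g i j).
  rewrite subrK -(absvN (M i j - _)) opprB => h; have := gA i j; lra.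
move=> A [_ [[B Bop <-] Bfs sBA]]; apply: filterS sBA _.
have [P MP PB] : nbhs (M : 'M[absv_space K]_n) B by exact: open_nbhs_nbhs.
have FP : F [set g : SL K n | forall ij : 'I_n * 'I_n, P ij.1 ij.2 (sval g ij.1 ij.2)].
  apply: filter_forall => -[i j] /=.
  have /nbhs_absv_space[e e0 eP] := MP i j.
  by apply: filterS (limM i j e e0) => g; apply: eP.
by apply: filterS FP => g gP; apply: PB => i j; apply: (gP (i, j)).
Qed.

End Compactness.

(** * Compactness of balls in finite extensions *)

Section HeineBorelExtension.
Variables (R : realType) (K0 K : absValuedFieldType R) (phi : {rmorphism K0 -> K}).
Hypothesis absv_phi : forall x, absv (phi x) = absv x :> R.
Variables (d : nat) (b : 'I_d -> K).

Lemma absv_lim_combination (T : Type) (F : set_system T) 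
    (x : 'I_d -> T -> K0) (l : 'I_d -> K0) :
  ProperFilter F -> (forall i, absv_lim F (x i) (l i)) ->
  absv_lim F (fun t => \sum_i phi (x i t) * b i) (\sum_i phi (l i) * b i).
Proof.
move=> FF xl; apply: (@absv_lim_sum R K T F FF _ (fun i t => phi (x i t) * b i)) => i.
apply: (@absv_limM R K T F FF (fun t => phi (x i t)) (fun=> b i)).
  by move=> e e0; apply: filterS (xl i e e0) => t /=; rewrite -rmorphB absv_phi.
exact: absv_lim_cst.
Qed.

(** The coordinates of a bounded element are bounded, so they converge along an
    ultrafilter, and the element converges with them. *)
Lemma heine_borel_extension (coor : 'I_d -> K -> K0) (C : R) :
  heine_borel K0 -> (forall x, x = \sum_i phi (coor i x) * b i) ->
  (forall i x, absv (coor i x) <= C * absv x) -> 0 <= C -> heine_borel K.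
Proof.
move=> hb coorE coorC C0 c; rewrite compact_ultra => F UF FA.
have /choice[l hl] : forall i, exists l, absv_lim F (fun x : K => coor i x) l.
  move=> i; apply: (ultra_absv_lim (c := C * c)) => //; apply: filterS FA => x /= xc.
  by rewrite (le_trans (coorC i x))// ler_wpM2l.
have Flim := @absv_lim_combination K F coor l (@ultra_proper _ _ UF) hl.
set L := \sum_i phi (l i) * b i in Flim.
have FL : absv_lim F (fun x : K => x) L.
  by move=> e e0; apply: filterS (Flim e e0) => x /=; rewrite -coorE.
exists L; split=> /=.
  rewrite leNgt; apply/negP => cL.
  have e0 : 0 < absv L - c by rewrite subr_gt0.
  have [x [/= xc xL]] := filter_ex (filterI FA (FL _ e0)).
  have := absvD (s := K) (L - x) x.
  rewrite subrK -(absvN (L - _)) opprB => h; lra.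
move=> A /nbhs_absv_space[e e0 eA]; apply: filterS (FL e e0); exact: eA.
Qed.

Hypothesis b_free : forall v : 'I_d -> K0,
  \sum_i phi (v i) * b i = 0 -> forall i, v i = 0.

(** Otherwise some combinations whose j-th coefficient is 1 would tend to 0, and
    their coefficients would have limits, forming a nontrivial relation. *)
Lemma combination_bounded_below j : heine_borel K0 -> exists2 e : R, 0 < e &
  forall v : 'I_d -> K0, v j = 1 -> (forall i, absv (v i) <= 1 :> R) ->
    e <= absv (\sum_i phi (v i) * b i).
Proof.
move=> hb; apply: contrapT => H.
have /choice[v hv] : forall m : nat, exists v : 'I_d -> K0, [/\ v j = 1,
    forall i, absv (v i) <= 1 :> R & absv (\sum_i phi (v i) * b i) < m.+1%:R^-1].
  move=> m; apply: contrapT => nv; apply: H; exists m.+1%:R^-1; first by rewrite invr_gt0.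
  move=> w w1 wle.
  by rewrite leNgt; apply/negP => lt; apply: nv; exists w.
have [F [UF sF]] := ultraFilterLemma (@eventually_filter).
have /choice[l hl] : forall i, exists l, absv_lim F (fun m => v m i) l.
  move=> i; apply: (ultra_absv_lim (c := 1)) => //.
  by apply: filterE => m; have [_ + _] := hv m; exact.
have lim1 := @absv_lim_combination nat F (fun i m => v m i) l (@ultra_proper _ _ UF) hl.
have lim0 : absv_lim F (fun m => \sum_i phi (v m i) * b i) 0.
  move=> e e0; apply: sF; have := near_infty_natSinv_lt (PosNum e0).
  apply: filterS => m /= me; rewrite subr0; have [_ _] := hv m.
  by move/lt_trans; apply.
have l0 := b_free (absv_lim_unique (@ultra_proper _ _ UF) lim1 lim0) j.
have : absv_lim F (fun m => v m j) 1.
  by move=> e e0; apply: filterE => m /=; have [-> _ _] := hv m; rewrite subrr absv0.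
move=> /(absv_lim_unique (@ultra_proper _ _ UF) (hl j)); rewrite l0 => /esym/eqP.
by rewrite oner_eq0.
Qed.

(** Divide v by its largest coordinate v j to reduce to v j = 1. *)
Lemma coordinates_bounded : heine_borel K0 -> exists2 C : R, 0 <= C &
  forall (v : 'I_d -> K0) i, absv (v i) <= C * absv (\sum_k phi (v k) * b k).
Proof.
move=> hb.
have /choice[e he] : forall j, exists e : R, 0 < e /\
  forall v : 'I_d -> K0, v j = 1 -> (forall i, absv (v i) <= 1 :> R) ->
    e <= absv (\sum_i phi (v i) * b i).
  by move=> j; have [e e0 h] := combination_bounded_below j hb; exists e.
exists (\sum_j (e j)^-1) => [|v i].
  by apply: sumr_ge0 => j _; rewrite invr_ge0 ltW//; case: (he j).
have [j _ /= vj] := @Order.TotalTheory.arg_maxP _ R _ i xpredT (fun k => absv (v k)) isT.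
have [vj0|vj0] := eqVneq (v j) 0.
  have -> : v i = 0.
    apply/eqP; rewrite -(absv_eq0 (s := K0)) eq_le absv_ge0 andbT.
    by have := vj i isT; rewrite vj0 absv0.
  rewrite absv0 mulr_ge0 ?absv_ge0// sumr_ge0// => k _.
  by rewrite invr_ge0 ltW//; case: (he k).
have av : 0 < absv (v j) :> R by rewrite lt_neqAle eq_sym absv_eq0 vj0 absv_ge0.
have [ej0 hj] := he j.
have := hj (fun k => v k / v j); rewrite divff// => /(_ erefl).
have wE : \sum_k phi (v k / v j) * b k = phi ((v j)^-1) * \sum_k phi (v k) * b k.
  rewrite mulr_sumr; apply: eq_bigr => k _; rewrite rmorphM; ring.
rewrite wE absvM absv_phi absvV ler_pdivlMl// => h.
have {}h : e j * absv (v j) <= absv (\sum_k phi (v k) * b k).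
  rewrite mulrC; apply: h => k; rewrite absvM absvV ler_pdivrMr// mul1r.
  exact: (vj k isT).
rewrite (le_trans (vj i isT))//.
have ej : (e j)^-1 <= \sum_k (e k)^-1.
  rewrite (bigD1 j)//= ler_wpDr// sumr_ge0// => k _.
  by rewrite invr_ge0 ltW//; case: (he k).
rewrite (le_trans _ (ler_wpM2r (absv_ge0 _) ej))//.
by rewrite ler_pdivlMl.
Qed.

End HeineBorelExtension.

(** * Compactness of balls in the p-adic and the real field *)

Section PadicField.
Variables (R : realType) (p : nat) (Q : absValuedFieldType R).
Hypothesis p_prime : prime p.
Hypothesis padicQ : is_padic_field p Q.

Let p_gt0 : (0 : R) < p%:R. Proof. by rewrite ltr0n prime_gt0. Qed.

Lemma padic_abs_int (m : int) : m != 0 ->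
  absv (m%:~R : Q) = (p%:R ^+ logn p `|m|%N)^-1 :> R.
Proof.
move=> m0; have [h _ _] := padicQ; have := h m%:~R.
rewrite ratr_int => ->; rewrite /padic_abs intr_eq0 (negPf m0).
by rewrite numq_int denq_int logn1 expr0 div1r.
Qed.

Lemma padic_char0 m : (0 < m)%N -> m%:R != 0 :> Q.
Proof.
move=> m0; rewrite -(absv_eq0 (s := Q)) -[m%:R]/(m%:~R).
rewrite padic_abs_int; last by rewrite -lt0n.
by rewrite invr_eq0 expf_neq0// gt_eqF.
Qed.

Lemma padic_absp N : absv (p%:R ^+ N : Q) = (p%:R ^+ N)^-1 :> R.
Proof.
rewrite -natrX -[(p ^ N)%N%:R]/((Posz (p ^ N)%N)%:~R) padic_abs_int ?pfactorK//.
by rewrite eqz_nat -lt0n expn_gt0 prime_gt0.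
Qed.

Lemma padic_abs_int_le1 (m : int) : absv (m%:~R : Q) <= 1 :> R.
Proof.
have [->|m0] := eqVneq m 0; first by rewrite absv0.
rewrite padic_abs_int// invf_le1 ?exprn_gt0// exprn_ege1//.
by rewrite ler1n prime_gt0.
Qed.

(** A p-integral rational is congruent to an integer modulo any power of p. *)
Lemma padic_integer_approx (q : rat) (M : nat) : absv (ratr q : Q) <= 1 :> R ->
  exists2 r : nat, (r < p ^ M)%N & absv (ratr q - r%:R : Q) <= (p%:R ^+ M)^-1 :> R.
Proof.
move=> q1; have pM0 : (0 < p ^ M)%N by rewrite expn_gt0 prime_gt0.
have d0 := denq_neq0 q.
have copd : coprime p `|denq q|.
  have [h _ _] := padicQ; move: q1; rewrite h /padic_abs.
  case: eqVneq => [-> _|q0]; first by rewrite coprimen1.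
  rewrite ler_pdivrMr ?exprn_gt0// mul1r => le.
  rewrite prime_coprime//; apply/negP => pd.
  have ld : (0 < logn p `|denq q|)%N.
    by rewrite logn_gt0 mem_primes p_prime pd absz_gt0 d0.
  have : (logn p `|denq q| <= logn p `|numq q|)%N.
    by move: le; rewrite ler_eXn2l// ltr1n prime_gt1.
  move=> /(leq_trans ld); rewrite logn_gt0 mem_primes => /and3P[_ _ pn].
  have : (p %| gcdn `|numq q| `|denq q|)%N by rewrite dvdn_gcd pn pd.
  by rewrite (eqP (coprime_num_den q)) Euclid_dvd1.
have /coprimezP[[u v]/= uv] : coprimez (denq q) ((p ^ M)%N%:Z).
  by rewrite coprimezE/= coprime_sym coprimeXl.
have absd : absv ((denq q)%:~R : Q) = 1 :> R.
  by rewrite padic_abs_int// logn_coprime// expr0 invr1.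
pose r := ((numq q * u) %% (p ^ M)%N%:Z)%Z.
have r0 : 0 <= r by rewrite modz_ge0// eqz_nat -lt0n.
have rlt : r < (p ^ M)%N%:Z by rewrite ltz_pmod.
exists `|r|%N; first by rewrite -ltz_nat gez0_abs.
pose w : int := numq q * v + ((numq q * u) %/ (p ^ M)%N%:Z)%Z * denq q.
have numE : numq q - r * denq q = w * (p ^ M)%N%:Z.
  have := divz_eq (numq q * u) (p ^ M)%N%:Z; rewrite -/r => rE.
  have -> : r = numq q * u - (numq q * u %/ (p ^ M)%N%:Z)%Z * (p ^ M)%N%:Z.
    by rewrite {1}rE addrC addKr.
  rewrite /w -{1}[numq q]mulr1 -uv; ring.
have -> : ratr q - (`|r|%N)%:R = (w%:~R * p%:R ^+ M) / (denq q)%:~R :> Q.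
  have dQ : (denq q)%:~R != 0 :> Q by rewrite -(absv_eq0 (s := Q)) absd oner_eq0.
  apply: (mulIf dQ); rewrite divfK// mulrBl /ratr divfK//.
  have -> : (`|r|%N)%:R = r%:~R :> Q by rewrite -[r in RHS]gez0_abs.
  by rewrite -intrM -intrB numE intrM -natrX.
rewrite absvM absvV absd invr1 mulr1 absvM padic_absp.
by rewrite ler_piMl ?padic_abs_int_le1// invr_ge0 exprn_ge0// ltW.
Qed.

Lemma padic_dense_rat (x : Q) (e : R) : 0 < e -> exists q : rat, absv (x - ratr q) < e.
Proof.
move=> e0; have [_ dense _] := padicQ.
have [] := dense [set y : absv_space Q | absv ((x : Q) - y) < e].
- by exists x; rewrite /= subrr absv0.
- rewrite openE => y /= xy; apply/nbhs_absv_space.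
  exists (e - absv ((x : Q) - y)); first by rewrite subr_gt0.
  move=> z /=; rewrite ltrBrDl; apply: le_lt_trans.
  have -> : (x : Q) - z = (x - y) - (z - y) by ring.
  by rewrite (le_trans (absvD _ _))// absvN.
by move=> y [/= xy [q _ qy]]; exists q; rewrite qy.
Qed.

(** [ratr] is multiplicative here because Q has characteristic 0. *)
Lemma padic_ratrMpow (q : rat) N :
  ratr (q * p%:R ^+ N) = ratr q * p%:R ^+ N :> Q.
Proof.
set q' := q * _.
have int0 (m : int) : m != 0 -> m%:~R != 0 :> Q.
  move=> m0; rewrite -(absv_eq0 (s := Q)) padic_abs_int//.
  by rewrite invr_eq0 expf_neq0// gt_eqF.
have dq := int0 _ (denq_neq0 q); have dq' := int0 _ (denq_neq0 q').
have numE : numq q' * denq q = numq q * (p ^ N)%N%:Z * denq q'.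
  apply: (@intr_inj rat); rewrite !intrM.
  have qE := divq_num_den q; have q'E := divq_num_den q'.
  have d0 : (denq q)%:~R != 0 :> rat by rewrite intr_eq0 denq_neq0.
  have d0' : (denq q')%:~R != 0 :> rat by rewrite intr_eq0 denq_neq0.
  have -> : (numq q')%:~R = q' * (denq q')%:~R by rewrite -{2}q'E divfK.
  have -> : (numq q)%:~R = q * (denq q)%:~R by rewrite -{2}qE divfK.
  have -> : (Posz (p ^ N)%N)%:~R = p%:R ^+ N :> rat by rewrite -natrX.
  rewrite /q'; ring.
rewrite /ratr; apply: (mulIf dq'); rewrite divfK//; apply: (mulIf dq).
rewrite -intrM numE !intrM.
have -> : (Posz (p ^ N)%N)%:~R = p%:R ^+ N :> Q by rewrite -natrX.
by field.
Qed.

(** An element of absolute value at most p^N is close to a rational, hence to some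
    r / p^N where r ranges over the integers modulo a large power of p. *)
Lemma padic_totally_bounded (c e : R) : 0 < e ->
  exists s : seq Q, forall x, absv x <= c -> exists2 y, y \in s & absv (x - y) < e.
Proof.
move=> e0.
have pow_gt (a : R) : exists N, a < p%:R ^+ N.
  exists (Num.bound `|a|); apply: (le_lt_trans (ler_norm a)).
  apply: (lt_trans (archi_boundP (normr_ge0 a))).
  by rewrite -natrX ltr_nat ltn_expl// prime_gt1.
have [N cN] := pow_gt (c + 1).
have [M NM] := pow_gt (2 * p%:R ^+ N / e).
exists [seq r%:R / p%:R ^+ N | r <- iota 0 (p ^ M)%N] => x xc.
have e'0 : 0 < Num.min 1 (e / 2) by rewrite lt_min ltr01 divr_gt0.
have [q] := padic_dense_rat x e'0; rewrite lt_min => /andP[q1 qe].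
have pN0 : 0 < p%:R ^+ N :> R by rewrite exprn_gt0.
have pM0 : 0 < p%:R ^+ M :> R by rewrite exprn_gt0.
have pNQ : p%:R ^+ N != 0 :> Q.
  by rewrite -(absv_eq0 (s := Q)) padic_absp invr_eq0 gt_eqF.
have qN : absv (ratr q : Q) <= p%:R ^+ N :> R.
  have := absvD (s := Q) (ratr q - x) x; rewrite subrK -(absvN (ratr q - x)) opprB => h.
  lra.
have [|r rM qr] := @padic_integer_approx (q * p%:R ^+ N) M.
  by rewrite padic_ratrMpow absvM padic_absp ler_pdivrMr// mul1r.
exists (r%:R / p%:R ^+ N); first by apply/mapP; exists r; rewrite ?mem_iota.
have -> : x - r%:R / p%:R ^+ N = (x - ratr q) + (ratr (q * p%:R ^+ N) - r%:R) / p%:R ^+ N.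
  by rewrite padic_ratrMpow; field.
rewrite (le_lt_trans (absvD _ _))// [e]splitr ltrD//.
rewrite absvM absvV padic_absp invrK.
rewrite (le_lt_trans (ler_wpM2r (ltW pN0) qr))// mulrC ltr_pdivrMr//.
by move: NM; rewrite ltr_pdivrMr//; lra.
Qed.

(** By total boundedness an ultrafilter containing a ball is Cauchy. *)
Lemma padic_heine_borel : heine_borel Q.
Proof.
move=> c; rewrite compact_ultra => F UF Fc.
have [_ _ complete] := padicQ.
have : cauchy F.
  apply: cauchy_exP => e e0; have [s hs] := padic_totally_bounded c e0.
  apply: contrapT => /forallNP nF.
  have : F [set x | forall i : 'I_(size s), ~ absv ((x : Q) - s`_i) < e].
    apply: filter_forall => i.
    have [Fb|//] := in_ultra_setVsetC [set x | absv ((x : Q) - s`_i) < e] UF.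
    exfalso; apply: (nF s`_i); apply: filterS Fb => x /=.
    by rewrite ballEmdist/= /mdist/= absv_dist_sym.
  move=> /(filterI Fc) /filter_ex[x [/= xc nx]].
  have [y ys xy] := hs x xc.
  have ys' : (index y s < size s)%N by rewrite index_mem.
  by apply: (nx (Ordinal ys')); rewrite /= nth_index.
move=> /(complete F _)/cvg_ex[l Fl]; exists l; split=> //=.
rewrite leNgt; apply/negP => cl.
have nl : nbhs l [set y : absv_space Q | absv ((y : Q) - l) < absv (l : Q) - c].
  by apply/nbhs_absv_space; exists (absv (l : Q) - c); rewrite ?subr_gt0.
have [x [/= xc xl]] := filter_ex (filterI Fc (Fl _ nl)).
have := absvD (s := Q) (l - x) x.
rewrite subrK -(absvN (l - _)) opprB => h; lra.
Qed.

End PadicField.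

(** A copy of R carrying the absolute value structure, so that R and R[i] are
    finite extensions of a field with compact balls, as in the p-adic case. *)
Definition real_line (R : realType) : Type := R.
HB.instance Definition _ (R : realType) := GRing.Field.on (real_line R).

Section RealLine.
Variable R : realType.
HB.instance Definition _ := @isAbsValued.Build R (real_line R) (fun x : R => `|x|)
  (@normr_ge0 R R) (@normr_eq0 R R) (@normrM R) (@ler_normD R R).

Lemma real_heine_borel : heine_borel (real_line R : absValuedFieldType R).
Proof.
move=> c; rewrite compact_ultra => F UF Fc.
have := @segment_compact R (- c) c; rewrite compact_ultra => /(_ F UF).
have Fc' : F `[- c, c]%classic.
  by apply: filterS Fc => x /=; rewrite in_itv/= -ler_norml.
move=> /(_ Fc')[l [/= lc Fl]]; exists l; split.
  by move: lc; rewrite /= in_itv/= -ler_norml.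
move=> A /nbhs_absv_space[e e0 eA]; apply: filterS eA _; apply: Fl.
by apply/nbhs_ballP; exists e => // y; rewrite /ball/= distrC.
Qed.

End RealLine.

(** * Local fields *)

Section LocalFields.
Variables (R : realType) (k : absValuedFieldType R).

Lemma real_field_heine_borel (f : {rmorphism R -> k}) :
  bijective f -> (forall x : R, absv (f x) = `|x|) -> heine_borel k.
Proof.
move=> [g fK gK] absf.
have h (x : real_line R) : absv ((f : {rmorphism real_line R -> k}) x) = absv x.
  exact: absf.
apply: (heine_borel_extension h (b := fun _ : 'I_1 => 1)
  (coor := fun=> g) (C := 1)) => //.
- exact: real_heine_borel.
- by move=> x; rewrite big_ord1 mulr1 /= gK.
- by move=> _ x; rewrite mul1r -{2}(gK x) absf.
Qed.

Lemma complex_field_heine_borel (f : {rmorphism R[i] -> k}) :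
  bijective f -> (forall z : R[i], (absv (f z))%:C%C = `|z|) -> heine_borel k.
Proof.
move=> [g fK gK] absf.
have absE z : absv (f z) = Num.sqrt (complex.Re z ^+ 2 + complex.Im z ^+ 2).
  by have := absf z; rewrite normc_def => /(congr1 (@complex.Re R)).
pose phi : {rmorphism real_line R -> k} := f \o (real_complex R).
have h (x : real_line R) : absv (phi x) = absv x.
  have := absE (real_complex R x); rewrite /= expr0n addr0 sqrtr_sqr; exact.
apply: (heine_borel_extension h (b := fun i : 'I_2 => if i == ord0 then 1 else f 'i%C)
  (coor := fun i x => if i == ord0 then complex.Re (g x) else complex.Im (g x))
  (C := 1)) => //.
- exact: real_heine_borel.
- move=> x; rewrite !big_ord_recl big_ord0 addr0 /= mulr1 -rmorphM -rmorphD -{1}(gK x).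
  by congr (f _); case: (g x) => a b; 
  apply/eqP; rewrite eq_complex/=; apply/andP; split; apply/eqP; ring.
- move=> i x; rewrite mul1r -[X in _ <= absv X]gK absE.
  case: ifP => _; rewrite -[leLHS]/(`|_|) -sqrtr_sqr ler_wsqrtr//.
    by rewrite lerDl sqr_ge0.
  by rewrite lerDr sqr_ge0.
Qed.

Lemma padic_extension_heine_borel (p : nat) (Qp : absValuedFieldType R)
    (L : fieldExtType Qp) (f : {rmorphism L -> k}) :
  prime p -> is_padic_field p Qp -> bijective f ->
  (forall x : Qp, absv (f x%:A) = absv x) -> heine_borel k.
Proof.
move=> pp padic [g fK gK] absf.
pose phi : {rmorphism Qp -> k} := f \o (in_alg L).
have h x : absv (phi x) = absv x by exact: absf.
pose B := vbasis {:L}; pose b (i : 'I_(\dim {:L})) := f B`_i.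
have combE (v : 'I_(\dim {:L}) -> Qp) : \sum_i phi (v i) * b i = f (\sum_i v i *: B`_i).
  rewrite rmorph_sum; apply: eq_bigr => i _.
  by rewrite /phi /b/= -rmorphM mulr_algl.
have coordE y : y = \sum_i coord B i y *: B`_i.
  by apply: coord_vbasis; exact: memvf.
have hb : heine_borel Qp := padic_heine_borel pp padic.
have b_free v : \sum_i phi (v i) * b i = 0 -> forall i, v i = 0.
  rewrite combE => /eqP; rewrite fmorph_eq0 => /eqP v0.
  by have /freeP := basis_free (vbasisP {:L}); apply.
have [C C0 hC] := coordinates_bounded h b_free hb.
apply: (heine_borel_extension h (b := b)
  (coor := fun i x => coord B i (g x)) hb _ _ C0) => [x|i x].
  by rewrite combE -coordE gK.
by rewrite (le_trans (hC (fun i => coord B i (g x)) i))// combE -coordE gK.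
Qed.

Lemma local_field_heine_borel : local_field_char0 k -> heine_borel k.
Proof.
case=> [[f [bf hf]]|[f [bf hf]]|[p [Qp [L [f [pp hQp bf hf]]]]]].
- exact: real_field_heine_borel bf hf.
- exact: complex_field_heine_borel bf hf.
- exact: padic_extension_heine_borel pp hQp bf hf.
Qed.

Lemma local_field_natr_neq0 : local_field_char0 k ->
  forall m, (0 < m)%N -> m%:R != 0 :> k.
Proof.
case=> [[f _]|[f _]|[p [Qp [L [f [pp hQp _ hf]]]]]] m m0.
- by rewrite -(rmorph_nat f) fmorph_eq0 pnatr_eq0 -lt0n.
- by rewrite -(rmorph_nat f) fmorph_eq0 pnatr_eq0 -lt0n.
- rewrite -(rmorph_nat f) -(rmorph_nat (in_alg L)) -(absv_eq0 (s := k)) hf absv_eq0.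
  exact: (padic_char0 pp hQp).
Qed.

End LocalFields.

(** * Proper actions *)

Section ProperActions.
Local Open Scope quotient_scope.
Variables (R : realType) (k : absValuedFieldType R) (n : nat).
Local Notation N := n.+2.
Variable Gam : set (SL k N).
Hypothesis hb : heine_borel k.
Hypothesis pd : properly_discontinuous (SL_corner k N) Gam.

(** g = x h y moves the coset of y^-1 to the coset of x, and both lie in the
    image of one compact subset of SL_n. *)
Lemma finite_bounded_double_coset (c : R) :
  finite_set [set g | Gam g /\ exists x h y, [/\ bounded_SL c x, SL_corner k N h,
    bounded_SL c y & g = (x * h * y)%g]].
Proof.
pose H := SL_corner k N.
pose B := [set g : SL k N | forall i j, absv (sval g i j) <= c].
have cB : compact B by exact: compact_entries_bounded.
pose pr (x : SL k N) : quotient_topology (coset_space H) := \pi_(coset_space H) x.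
have cL : compact (pr @` B).
  by apply: continuous_compact => //; apply: continuous_subspaceT; exact: pi_continuous.
apply: sub_finite_set (pd cL) => g [Gg [x [h [y [bx Hh by_ gE]]]]]; split=> //.
have Bx : B x.
  by have [w [_ xc _]] := bx => i j; exact: le_trans (absv_le_mxnorm _ _ _) xc.
have By : B y^-1%g.
  have [w [yw _ wc]] := by_ => i j; have -> : sval y^-1%g = w.
    by rewrite -[w]mul1mx -(mulmx1C (SL_valV y)) -mulmxA yw mulmx1.
  by rewrite (le_trans (absv_le_mxnorm w i j)).
exists (pr x); split; last by exists x.
exists (pr y^-1%g); first by exists y^-1%g.
rewrite /pr coset_actE gE mulgK; apply/eqmodP/asboolP.
exact: left_coset_corner.
Qed.

End ProperActions.

Section AlmostInvariantSet.
Variables (R : realType) (k : absValuedFieldType R) (n d : nat).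
Variable Gam : set (SL k n).
Hypothesis dn : (d + d = n.+1)%N.
Hypothesis finite_middle : forall C : R, 0 < C -> finite_set [set g | Gam g /\
  ~ (expanding d C (sval g) \/ contracting d C^-1 (sval g))].

Definition expanding_set : set (SL k n) := [set g | expanding d 1 (sval g)].

Let lt_nd : (n < d + d)%N. Proof. by rewrite dn. Qed.

Lemma not_contracting (c : R) (g : SL k n) : c < 1 -> contracting d c (sval g) ->
  ~ expanding_set g.
Proof.
move=> c1 cg eg; have := expanding_contracting lt_nd eg cg.
by rewrite leNgt c1.
Qed.

(* Multiplication by a moves a subspace expanded by size_of a, or contracted by
   its inverse, to one that still is expanded by 1, or contracted by less than 1. *)
Let size_of (a : SL k n) : R := 2 + mxnorm (sval a) + mxnorm (sval a^-1%g).

Let size_gt1 (a : SL k n) : 1 < size_of a.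
Proof.
rewrite /size_of; have := mxnorm_ge0 (sval a); have := mxnorm_ge0 (sval a^-1%g); lra.
Qed.

Let size_gt0 (a : SL k n) : 0 < size_of a. Proof. exact: lt_trans (size_gt1 a). Qed.

Let size_ge (a : SL k n) : mxnorm (sval a^-1%g) <= size_of a.
Proof. by rewrite /size_of; have := mxnorm_ge0 (sval a); lra. Qed.

Let size_lt (a : SL k n) : (size_of a)^-1 * mxnorm (sval a) < 1.
Proof.
rewrite mulrC ltr_pdivrMr// mul1r /size_of.
by have := mxnorm_ge0 (sval a^-1%g); lra.
Qed.

Let inv_size_lt (a : SL k n) : (size_of a)^-1 < 1.
Proof. by rewrite invf_lt1. Qed.

Let inv_size_ge0 (a : SL k n) : 0 <= (size_of a)^-1.
Proof. by rewrite invr_ge0 ltW. Qed.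

Lemma expanding_set_right a : Gam a ->
  finite_set [set g | Gam g /\ ~ (expanding_set (g * a)%g <-> expanding_set g)].
Proof.
move=> Ga; apply: sub_finite_set (finite_middle (size_gt0 a)) => g [Gg ne].
split=> // -[eg|cg]; apply: ne; split=> Hex.
- exact: expandingW (ltW (size_gt1 a)) eg.
- have := expandingMr (size_gt0 a) (SL_valV a) (size_ge a) eg.
  by rewrite divff ?gt_eqF.
- by case: (not_contracting (size_lt a) _ Hex); exact: contractingMr.
- by case: (not_contracting (inv_size_lt a) cg Hex).
Qed.

Lemma expanding_set_left a : Gam a ->
  finite_set [set g | Gam g /\ ~ (expanding_set (a * g)%g <-> expanding_set g)].
Proof.
move=> Ga; apply: sub_finite_set (finite_middle (size_gt0 a)) => g [Gg ne].
split=> // -[eg|cg]; apply: ne; split=> Hex.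
- exact: expandingW (ltW (size_gt1 a)) eg.
- have := expandingMl (ltW (size_gt0 a)) (size_gt0 a) (SL_valV a) (size_ge a) eg.
  by rewrite divff ?gt_eqF.
- case: (not_contracting (size_lt a) _ Hex).
  exact: contractingMl (inv_size_ge0 a) (SL_valV a) (lexx _) cg.
- by case: (not_contracting (inv_size_lt a) cg Hex).
Qed.

(** Here n = 2 d - 1 matters: g expands on dimension d exactly when g^-1
    contracts on the same dimension d, and this excludes that g^-1 expands on a
    subspace of dimension d. *)
Lemma expanding_set_inv :
  finite_set [set g | Gam g /\ (expanding_set g^-1%g <-> expanding_set g)].
Proof.
have lt1 : 2^-1 < 1 :> R by rewrite invf_lt1// ltr1n.
apply: sub_finite_set (finite_middle (ltr0n R 2)) => g [Gg e]; split=> // -[eg|cg].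
  have : expanding_set g by apply: expandingW eg; rewrite ler1n.
  move/e; apply: not_contracting lt1 _.
  exact: expanding_inv (ltr0n R 2) (SL_valV g) eg.
have : expanding_set g^-1%g.
  have := contracting_inv _ (SL_valV g) cg; rewrite invrK invr_gt0 ltr0n => /(_ isT).
  by apply: expandingW; rewrite ler1n.
by move/e; apply: not_contracting lt1 cg.
Qed.

End AlmostInvariantSet.

Theorem mainTheorem4 (R : realType) (k : absValuedFieldType R) (n : nat)
    (Gam : set (SL k n)) :
  local_field_char0 k -> (3 <= n)%N -> odd n ->
  group_closed (mem Gam) -> discrete_subset Gam ->
  properly_discontinuous (SL_corner k n) Gam ->
  virtually_cyclic Gam.
Proof.
move=> lk n3 nodd grp _ pd.
have hb := local_field_heine_borel lk.
have G1 : Gam 1%g by have [+ _] := grp; rewrite inE.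
have GV x : Gam x -> Gam x^-1%g.
  by move=> Gx; have := group_closedV grp; move=> /(_ x); rewrite !inE; apply.
have GM x y : Gam x -> Gam y -> Gam (x * y)%g.
  by move=> Gx Gy; have := group_closedM grp; move=> /(_ x y); rewrite !inE; apply.
have dn : ((uphalf n) + (uphalf n) = n.+1)%N by rewrite uphalf_half nodd; lia.
have finX : forall c : R, finite_set [set g | Gam g /\ exists x h y,
    [/\ bounded_SL c x, SL_corner k n h, bounded_SL c y & g = (x * h * y)%g]].
  move: n3 Gam pd {grp G1 GV GM dn nodd}; case: n => [|[|n']]// _ Gam' pd c.
  exact: finite_bounded_double_coset.
have [c c0 hc] := expanding_or_contracting_or_middle k dn.
have fin_middle (C : R) : 0 < C -> finite_set [set g | Gam g /\
    ~ (expanding (uphalf n) C (sval g) \/ contracting (uphalf n) C^-1 (sval g))].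
  move=> C0; have [T T0 hT] := hc C C0.
  have [c' hc'] : exists c' : R, forall g : SL k n,
      (exists u v (a : 'rV_n) i, [/\ bounded_unit c u, bounded_unit c v,
        sval g = u *m diag_mx a *m v, T^-1 < absv (a 0 i) & absv (a 0 i) < T]) ->
      exists x h y, [/\ bounded_SL c' x, SL_corner k n h, bounded_SL c' y &
        g = (x * h * y)%g].
    move: n3; clear -T0; case: n => [|[|n']]// _; exact: middle_factor.
  apply: sub_finite_set (finX c') => g [Gg nec]; split=> //; apply: hc'.
  by have [eg|cg|//] := hT (sval g); case: nec; [left|right].
have Al := expanding_set_left dn fin_middle.
have Ar := expanding_set_right dn fin_middle.
have Ai := expanding_set_inv dn fin_middle.
have [[g Gg ginf]|tors] :=
  pselect (exists2 g, Gam g & forall m, (0 < m)%N -> (g ^+ m)%g <> 1%g).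
  exact: (virtually_cyclic_infinite_order G1 GM GV Al Ar Ai Gg ginf).
have {}tors g : Gam g -> exists2 m, (0 < m)%N & (g ^+ m)%g = 1%g.
  move=> Gg; apply: contrapT => ng; apply: tors; exists g => // m m0 gm.
  by apply: ng; exists m.
have lf S := @torsion_locally_finite _ Gam _ G1 GM Ar Ai S tors.
have [b hbd] := torsion_bounded (local_field_natr_neq0 lk) G1 GM GV tors lf.
have finG : finite_set Gam.
  apply: sub_finite_set (finX (Num.max b n%:R)) => g Gg; split=> //.
  exists g, 1%g, 1%g; split; rewrite ?mulg1//.
  - exists (sval g^-1%g); split; first exact: SL_valV.
      by rewrite le_max hbd.
    by rewrite le_max hbd//; apply: GV.
  - by move: n3; clear; case: n => // n' _; exists 1%g; rewrite corner_mx1.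
  - by exists 1%:M; rewrite mulmx1 mxnorm1 le_max lexx orbT.
by exists 1%g => //; exact: finite_image.
Qed.
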